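(* Let $k$ be an integer with $k\geq 2$ and let $n\ge 3$ be an integer divisible by $k$. For every balanced $k$-partite graph $G$ on $n$ vertices, if $$\delta(G)\;\geq\;\left\lceil\frac{n}{2}\right\rceil+\left\lfloor\frac{n+2}{2\left\lceil\frac{k+1}{2}\right\rceil}\right\rfloor-\frac{n}{k}\;=\;\begin{cases}\left\lceil\frac{n}{2}\right\rceil+\left\lfloor\frac{n+2}{k+1}\right\rfloor-\frac{n}{k} & \text{if } k \text{ is odd},\\[4pt] \frac{n}{2}+\left\lfloor\frac{n+2}{k+2}\right\rfloor-\frac{n}{k} & \text{if } k \text{ is even},\end{cases}$$ then $G$ has a Hamiltonian cycle, unless $k=2$ and $4$ divides $n$, or $k=\frac{n}{2}$ and $4$ divides $n$.
   Context: All graphs are finite and simple. A balanced $k$-partite graph on $n$ vertices is a graph whose vertex set is partitioned into $k$ independent sets (parts) $V_1,\dots,V_k$, each of size exactly $n/k$ (so $k$ divides $n$). $\delta(G)$ denotes the minimum degree of $G$. A Hamiltonian cycle is a cycle containing every vertex of $G$. *)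

(* Defs.v *)
From mathcomp Require Import all_boot.

Set Implicit Arguments.
Unset Strict Implicit.
Unset Printing Implicit Defensive.

Record sgraph := SGraph {
  vertex :> finType;
  adj : rel vertex;
  adj_sym : symmetric adj;
  adj_irr : irreflexive adj
}.

Definition degree (G : sgraph) (x : G) : nat := #|[set y | adj x y]|.

(* Every degree is at most #|G|, so the default value #|G| does not affect
   the minimum as soon as G has a vertex. *)
Definition min_degree (G : sgraph) : nat :=
  \big[minn/#|G|]_(x : G) degree x.

Definition independent (G : sgraph) (A : {set G}) : Prop :=
  {in A &, forall x y, ~~ adj x y}.

(* [partition] also requires the parts to be nonempty; this is automatic
   when n > 0 and k divides n, the parts then having size n / k > 0. *)
Definition balanced_partition (k : nat) (G : sgraph) (P : {set {set G}}) : Prop :=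
  [/\ partition P [set: G], #|P| = k
    & {in P, forall A, independent A /\ #|A| = #|G| %/ k}].

Definition balanced_kpartite (k n : nat) (G : sgraph) : Prop :=
  [/\ #|G| = n, k %| n & exists P : {set {set G}}, balanced_partition k P].

(* The condition 2 < size c is needed because [cycle] accepts a single edge
   traversed back and forth as a cycle of length 2. *)
Definition hamiltonian_cycle (G : sgraph) (c : seq G) : Prop :=
  [/\ 2 < size c, cycle (@adj G) c, uniq c & forall x : G, x \in c].

Definition hamiltonian (G : sgraph) : Prop :=
  exists c : seq G, hamiltonian_cycle c.

(* [uphalf m] is the ceiling of m / 2. The subtraction is never truncated for
   k >= 2, since then n / k <= n / 2. *)
Definition degree_bound (k n : nat) : nat :=
  uphalf n + (n + 2) %/ (2 * uphalf (k + 1)) - n %/ k.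

(* Main.v *)
Require Import Defs.
From mathcomp Require Import all_boot zify.

(** Let [G] be an edge-maximal counterexample with parts of size [m] and minimum
    degree at least [d], where [n = k m]. Maximality gives a Hamiltonian path; for
    [k = 2] its ends violate Ore's inequality. For [k > 2], rotations of a
    Hamiltonian path produce one whose ends have crossing neighbours, and a closest
    crossing yields a cycle together with a disjoint path of at most [n - 2d]
    vertices covering [G]; shortening that path leaves a cycle [c] missing a single
    vertex [v].

    Woodall's hopping lemma then gives a set [X] on [c] without consecutive
    vertices such that [v], and every vertex of the set [Y] of those lying on [c]
    between two members of [X], has all its neighbours in [X]. Each part meeting
    [Y + v] contains at most [|X| - d] vertices of [X], so [Y + v] meets at most
    [k / 2] parts; a vertex outside [X] in one of the other parts has no neighbour
    in [Y + v], which bounds [d] from above. For [k = 4] and [k = 6] this must be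
    combined with the independence of the set of successors of [X], and the
    extremal case for [k = 4] with one more exchange of cycle segments. *)

Set Implicit Arguments.
Unset Strict Implicit.
Unset Printing Implicit Defensive.

(** * Sequences as paths and cycles *)

Section Walks.

Variables (T : eqType) (x0 : T).
Implicit Types (r : rel T) (s : seq T).

Lemma head_rev s : head x0 (rev s) = last x0 s.
Proof. by case/lastP: s => // s x; rewrite rev_rcons last_rcons. Qed.

Lemma last_rev s : last x0 (rev s) = head x0 s.
Proof. by rewrite -head_rev revK. Qed.

Lemma head_cat_ne s1 s2 : s1 != [::] -> head x0 (s1 ++ s2) = head x0 s1.
Proof. by case: s1. Qed.

Lemma last_cat_ne s1 s2 : s2 != [::] -> last x0 (s1 ++ s2) = last x0 s2.
Proof. by case: s2 => // a s2 _; rewrite last_cat. Qed.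

Lemma rev_nil_eq s : (rev s == [::]) = (s == [::]).
Proof. by rewrite -!size_eq0 size_rev. Qed.

Lemma cat_nil_eq s1 s2 : (s1 ++ s2 == [::]) = (s1 == [::]) && (s2 == [::]).
Proof. by case: s1. Qed.

Lemma sorted_cat_ne r s1 s2 : s1 != [::] -> s2 != [::] ->
  sorted r (s1 ++ s2) =
  [&& sorted r s1, sorted r s2 & r (last x0 s1) (head x0 s2)].
Proof.
case: s1 s2 => [//|a s1] [//|b s2] _ _ /=.
by rewrite cat_path /= [r _ b && _]andbC.
Qed.

Lemma cycle_sortedE r s : s != [::] ->
  cycle r s = sorted r s && r (last x0 s) (head x0 s).
Proof. by case: s => // a s _ /=; rewrite rcons_path. Qed.

Lemma sorted_rev_sym r s : symmetric r -> sorted r (rev s) = sorted r s.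
Proof. by move=> rC; rewrite rev_sorted; apply: eq_sorted => a b; rewrite rC. Qed.

Lemma head_in s : s != [::] -> head x0 s \in s.
Proof. by case: s => // a s _; rewrite mem_head. Qed.

Lemma last_in s : s != [::] -> last x0 s \in s.
Proof. by case: s => // a s _; rewrite /= mem_last. Qed.

(** Follow [s1], jump between the last vertices, return along [s2] and close up through the
    heads. *)
Lemma crossing_cycle r s1 s2 : symmetric r ->
  s1 != [::] -> s2 != [::] -> sorted r s1 -> sorted r s2 ->
  r (head x0 s1) (head x0 s2) -> r (last x0 s1) (last x0 s2) ->
  cycle r (s1 ++ rev s2).
Proof.
move=> rC s1n s2n ps1 ps2 hh ll.
have s2n' : rev s2 != [::] by rewrite rev_nil_eq.
rewrite cycle_sortedE ?cat_nil_eq ?(negPf s1n) //.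
rewrite sorted_cat_ne // sorted_rev_sym // head_cat_ne // last_cat_ne //.
by rewrite head_rev last_rev ps1 ps2 ll rC hh.
Qed.

(* The rotation of Posa. *)
Lemma sorted_rotation r s1 s2 : symmetric r ->
  s1 != [::] -> s2 != [::] -> sorted r (s1 ++ s2) ->
  r (head x0 s1) (head x0 s2) -> sorted r (rev s1 ++ s2).
Proof.
move=> rC s1n s2n; rewrite sorted_cat_ne // => /and3P[p1 p2 _] hh.
by rewrite sorted_cat_ne ?rev_nil_eq // sorted_rev_sym // last_rev p1 p2.
Qed.

Lemma prev_head x s : uniq (x :: s) -> prev (x :: s) x = last x s.
Proof.
move=> us; have := prev_next us (last x s).
suff -> : next (x :: s) (last x s) = x by [].
have := next_nth (x :: s) (last x s); rewrite mem_last => ->.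
by rewrite index_last //= nth_default.
Qed.

Lemma next_last s : uniq s -> next s (last x0 s) = head x0 s.
Proof.
by case: s => // a s us; rewrite -[last _ _]/(last a s) -(prev_head us) next_prev.
Qed.

Lemma next_adjacent s1 a b s2 :
  uniq (s1 ++ a :: b :: s2) -> next (s1 ++ a :: b :: s2) a = b.
Proof.
move=> us; rewrite -(next_rot (size s1) us) rot_size_cat.
by rewrite /= eqxx.
Qed.

Lemma prev_adjacent s1 a b s2 :
  uniq (s1 ++ a :: b :: s2) -> prev (s1 ++ a :: b :: s2) b = a.
Proof. by move=> us; have := prev_next us a; rewrite next_adjacent. Qed.

End Walks.

(** * Hamiltonian cycles and edge-maximal graphs *)

Section Hamiltonicity.

Variable T : finType.
Implicit Types (r : rel T) (s : seq T).

(** A tuple of length [#|T|] makes existence boolean, so that edge-maximality can be decided by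
    cases; the length condition on cycles is recovered from [2 < #|T|]. *)
Definition hamb r := [exists c : #|T|.-tuple T, cycle r c && uniq c].

Definition spans s := uniq s && (size s == #|T|).

Lemma spans_mem s x : spans s -> x \in s.
Proof.
case/andP=> us /eqP ss; have := uniq_min_size us (s2 := enum T).
have sub : {subset s <= enum T} by move=> a _; rewrite mem_enum.
by rewrite -cardE ss leqnn => /(_ sub isT) [_ ->]; rewrite mem_enum.
Qed.

Lemma spans_perm s s' : perm_eq s s' -> spans s -> spans s'.
Proof. by move=> ss; rewrite /spans (perm_uniq ss) (perm_size ss). Qed.

Lemma hambP r : reflect (exists2 c, cycle r c & spans c) (hamb r).
Proof.
apply: (iffP existsP) => [[c /andP[rc uc]]|[c rc /andP[uc sc]]].
  by exists c => //; rewrite /spans uc size_tuple eqxx.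
by exists (Tuple sc); rewrite /= rc.
Qed.

Lemma cycle_break r c : uniq c -> ~~ cycle r c ->
  exists2 x, x \in c & ~~ r x (next c x).
Proof.
move=> uc nrc; have: ~~ all (fun x => r x (next c x)) c.
  by apply: contra nrc => /allP H; apply: cycle_from_next.
by case/allPn=> x xc nx; exists x.
Qed.

(** Some step of the cycle is not an [r]-edge and hence is the added edge; cutting the cycle there
    leaves a path joining [x] and [y]. *)
Lemma saturation_step r x y c : symmetric r ->
  let r' := fun a b => r a b || ((a, b) \in [:: (x, y); (y, x)]) in
  cycle r' c -> uniq c -> 2 < size c -> ~~ cycle r c ->
  exists s, [/\ perm_eq s c, sorted r s, head x s = x & last x s = y].
Proof.
move=> rC r' r'c uc cs /(cycle_break uc) [a ac nra].
have := next_cycle r'c ac; rewrite /r' (negPf nra) /= => ab.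
have bc : next c a \in c by rewrite mem_next.
move: bc ab (prev_next uc a); set b := next c a => bc ab pb.
have [i p Ec] := rot_to bc.
have up : uniq (b :: p) by rewrite -Ec rot_uniq.
have la : last b p = a.
  by rewrite -prev_head // -Ec prev_rot // pb.
have pe : perm_eq (b :: p) c by rewrite -Ec perm_rot.
have sz : 1 < size p by move: cs; rewrite -(perm_size pe).
have r'p : path r' b p.
  by move: r'c; rewrite -(rot_cycle i) Ec /= rcons_path => /andP[].
have nab : ((a == x) && (b == y)) || ((a == y) && (b == x)).
  by move: ab; rewrite !inE !xpair_eqE.
have rp : path r b p.
  clear Ec pe; move: la up sz r'p; case: p => //= d [//|e p] la /andP[bp udp] _.
  move=> /andP[bd dp].
  have dl : d != a.
    by rewrite -la /=; apply: contraL udp => /eqP dE /=; rewrite dE mem_last.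
  have db : d != b by move: bp; rewrite inE eq_sym; case/norP.
  apply/andP; split.
    move: bd; rewrite /r' !inE !xpair_eqE => /orP[//|H].
    by case/orP: nab H db dl => /andP[/eqP-> /eqP->] /orP[]/andP[/eqP ? /eqP ->];
       rewrite ?eqxx.
  apply: (sub_in_path (P := fun z => z != b) _ _ dp).
    move=> z w; rewrite !unfold_in /= => zb wb; rewrite /r' !inE !xpair_eqE => /orP[//|H].
    move: zb wb H; case/orP: nab => /andP[_ /eqP->] /negPf-> /negPf->;
    by rewrite !andbF.
  by apply/allP => z zd; apply: contraNneq bp => <-.
case/orP: nab => /andP[/eqP aE /eqP bE]; last first.
  by exists (b :: p); split => //=; rewrite la.
exists (rev (b :: p)); split.
- by apply: perm_trans pe; rewrite perm_rev.
- by rewrite sorted_rev_sym.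
- by rewrite head_rev /= la.
- by rewrite last_rev.
Qed.

(* Bondy-Chvatal: an edge-maximal non-Hamiltonian graph inside [r1] above [r]. *)
Lemma saturation r1 r : 2 < #|T| -> symmetric r -> symmetric r1 ->
  subrel r r1 -> ~~ hamb r ->
  exists r2 : rel T, [/\ symmetric r2, subrel r r2, subrel r2 r1, ~~ hamb r2 &
    forall x y, r1 x y -> ~~ r2 x y ->
      exists s, [/\ spans s, sorted r2 s, head x s = x & last x s = y]].
Proof.
move=> T3; have [n] := ubnP #|[set p : T * T | r1 p.1 p.2 && ~~ r p.1 p.2]|.
elim: n r => // n IH r le_n rC r1C rr1 hr.
pose ext x y : rel T := fun a b => r a b || ((a, b) \in [:: (x, y); (y, x)]).
have extC x y : symmetric (ext x y).
  move=> a b; rewrite /ext rC !inE !xpair_eqE; congr (_ || _).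
  by rewrite orbC [(a == y) && _]andbC [(a == x) && _]andbC.
(* Either one more edge of [r1] can be added without creating a Hamiltonian cycle, and the induction
   applies, or [r] is already maximal. *)
case: (boolP [exists p : T * T,
   [&& r1 p.1 p.2, ~~ r p.1 p.2 & ~~ hamb (ext p.1 p.2)]]).
  case/existsP=> -[x y] /= /and3P[r1xy nrxy nh].
  have [||r2 [r2C sub s12 h2 sat]] := IH (ext x y) _ (extC x y) r1C _ nh.
  - rewrite -ltnS; apply: leq_trans le_n; rewrite ltnS; apply: proper_card.
    apply/properP; split.
      by apply/subsetP=> -[a b]; rewrite !inE /ext /= => /andP[-> /norP[->]].
    by exists (x, y); rewrite !inE /ext /= ?r1xy ?nrxy // mem_head orbT andbF.
  - move=> a b; rewrite /ext !inE !xpair_eqE => /or3P[/rr1//||];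
    by case/andP=> /eqP-> /eqP->; rewrite // r1C.
  by exists r2; split=> // a b rab; apply: sub; rewrite /ext rab.
move/existsPn => H; exists r; split=> // x y r1xy nrxy.
have := H (x, y); rewrite /= r1xy nrxy negbK /= => /hambP[c cc sc].
have /andP[uc zc] := sc.
have [||s [ps rs hs ls]] := saturation_step rC cc uc.
- by rewrite (eqP zc).
- by apply: contra hr => rc; apply/hambP; exists c.
by exists s; split=> //; apply: spans_perm sc; rewrite perm_sym.
Qed.

End Hamiltonicity.

(** * Ore's argument on the ends of a Hamiltonian path *)

Section Paths.

Variables (T : finType) (e : rel T) (x0 : T).
Hypotheses (eC : symmetric e) (eI : irreflexive e).
Implicit Types (s : seq T).

Definition nbr x := [set y | e x y].

Lemma in_nbr x y : (y \in nbr x) = e x y.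
Proof. by rewrite inE. Qed.

Lemma split_before s b : b \in s -> b != head x0 s ->
  exists s1 a s2, s = s1 ++ a :: b :: s2.
Proof.
case/splitPr=> s1 s2; case/lastP: s1 => [|s1 a _]; first by rewrite eqxx.
by exists s1, a, s2; rewrite cat_rcons.
Qed.

Lemma split_after s a : a \in s -> a != last x0 s ->
  exists s1 b s2, s = s1 ++ a :: b :: s2.
Proof.
case/splitPr=> s1 s2; case: s2 => [|b s2 _]; first by rewrite last_cat eqxx.
by exists s1, b, s2.
Qed.

(** The two chords replace the edge [a b]: go from the head to [a], jump to the tail, walk back to
    [b] and return to the head. *)
Lemma no_adjacent_crossing s1 a b s2 : ~~ hamb e ->
  spans (s1 ++ a :: b :: s2) -> sorted e (s1 ++ a :: b :: s2) ->
  e (head x0 (s1 ++ a :: b :: s2)) b ->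
  e (last x0 (s1 ++ a :: b :: s2)) a -> False.
Proof.
rewrite -[a :: b :: s2]/([:: a] ++ b :: s2) catA => nh sp.
have s1n : s1 ++ [:: a] != [::] by case: s1 {sp}.
rewrite (sorted_cat_ne x0) // => /and3P[p1 p2 _].
rewrite head_cat_ne // last_cat_ne // => hb la; case/negP: nh.
apply/hambP; exists ((s1 ++ [:: a]) ++ rev (b :: s2)).
  by apply: (crossing_cycle (x0 := x0)) => //; rewrite last_cat /= eC.
by apply: spans_perm sp; rewrite perm_cat2l perm_sym perm_rev.
Qed.

(** Ore's count, sharpened by [Q]: the path predecessors of the neighbours of the head, the
    neighbours of the tail, and [Q] are pairwise disjoint, and all three miss the tail. *)
Lemma ore_gap s (Q : {set T}) : ~~ hamb e -> spans s -> sorted e s ->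
  last x0 s \notin Q ->
  {in Q, forall y, ~~ e (last x0 s) y && ~~ e (head x0 s) (next s y)} ->
  #|nbr (head x0 s)| + #|nbr (last x0 s)| + #|Q| < #|T|.
Proof.
move=> nh sp ps lQ HQ; have /andP[us _] := sp.
set h := head x0 s in HQ *; set l := last x0 s in lQ HQ *.
pose A := [set prev s y | y in nbr h].
have cA : #|A| = #|nbr h|.
  by apply: card_imset; apply: can_inj (next_prev us).
have inA a : (a \in A) = e h (next s a).
  apply/imsetP/idP => [[b]|eh]; first by rewrite inE => eb ->; rewrite next_prev.
  by exists (next s a); rewrite ?inE // prev_next.
have lA : l \notin A.
  by rewrite inA /l next_last // -/h eI.
have dAB a : a \in A -> a \in nbr l -> False.
  rewrite inA inE => ha la.
  have al : a != l by apply: contraTneq la => ->; rewrite eI.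
  have [s1 [b [s2 Es]]] := split_after (spans_mem a sp) al.
  move: ha; rewrite Es next_adjacent -?Es // => hb.
  by apply: (@no_adjacent_crossing s1 a b s2); rewrite -?Es.
have dU : [disjoint A & nbr l].
  by apply/pred0P => a /=; apply/andP => -[]; apply: dAB.
have dQ : [disjoint A :|: nbr l & Q].
  rewrite disjoint_subset; apply/subsetP => a; rewrite !inE inA => H.
  apply/negP => aQ; have /andP[n1 n2] := HQ a aQ.
  by rewrite (negPf n1) (negPf n2) in H.
rewrite -cA -(cardsUI A) (disjoint_setI0 dU) cards0 addn0.
rewrite -(cardsUI _ Q) (disjoint_setI0 dQ) cards0 addn0.
rewrite -cardsT; apply: proper_card; apply/properP; split; first exact/subsetP.
by exists l; rewrite ?in_setT // !in_setU (negPf lA) (negPf lQ) inE eI.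
Qed.

End Paths.

(** * Multipartite graphs and crossings *)

Section CompleteMultipartite.

Variables (T L : finType) (pt : T -> L) (m : nat).
Hypothesis card_part : forall l, #|[set x | pt x == l]| = m.

Lemma card_parts_sum (D : {set T}) :
  \sum_l #|[set x in D | pt x == l]| = #|D|.
Proof.
rewrite -sum1_card (partition_big pt predT) //=; apply: eq_bigr => l _.
by rewrite -sum1_card; apply: eq_bigl => x; rewrite inE.
Qed.

Lemma card_vertices : #|T| = #|L| * m.
Proof.
rewrite -cardsT -card_parts_sum -sum_nat_const; apply: eq_bigr => l _.
by rewrite -(card_part l); apply: eq_card => x; rewrite !inE.
Qed.

(** Dirac's argument: saturate inside the complete graph. Every degree is at least [n - m], hence at
    least [n / 2], and the ends of a Hamiltonian path then violate Ore's count. The lemma guarantees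
    that a saturated multipartite graph still lacks an edge between two parts. *)
Lemma complete_multipartite_ham : 1 < #|L| -> 2 < #|T| ->
  hamb (fun x y => pt x != pt y).
Proof.
move=> k2 n3; pose r1 : rel T := fun x y => pt x != pt y.
rewrite -/r1; apply: contraT => nh.
pose r0 : rel T := fun x y => x != y.
have r1C : symmetric r1 by move=> x y; rewrite /r1 eq_sym.
have r0C : symmetric r0 by move=> x y; rewrite /r0 eq_sym.
have r10 : subrel r1 r0 by move=> x y; apply: contraNN => /eqP->.
have [r2 [r2C s12 s20 nh2 sat]] := saturation n3 r1C r0C r10 nh.
(* Read as a cycle, the enumeration of [T] must contain a step that is not an edge; this is the
   missing pair fed to [sat]. *)
have ut : uniq (enum T) by apply: enum_uniq.
have sT : spans (enum T) by rewrite /spans ut -cardE eqxx.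
have nc : ~~ cycle r2 (enum T).
  by apply: contra nh2 => ct; apply/hambP; exists (enum T).
have [x xT nr] := cycle_break ut nc.
have [i p Ep] := rot_to xT.
have up : uniq (x :: p) by rewrite -Ep rot_uniq.
have sp : size (x :: p) = #|T| by rewrite -Ep size_rot -cardE.
have xn : r0 x (next (enum T) x).
  rewrite -(next_rot i ut) Ep; move: up sp n3; case: (p) => [_ <- //|b q] /= ub _ _.
  by rewrite eqxx /r0; move: ub; rewrite inE => /andP[/norP[]].
have [s [ss ps hs ls]] := sat _ _ xn nr.
have r2I : irreflexive r2.
  by move=> z; apply/negP => /s20; rewrite /r0 eqxx.
have := ore_gap (x0 := x) (Q := set0) r2C r2I nh2 ss ps.
rewrite hs ls inE cards0 addn0 => /(_ isT).
have H z : (#|L|.-1) * m <= #|nbr r2 z|.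
  apply: leq_trans (_ : #|~: [set y | pt y == pt z]| <= _).
    by rewrite cardsCs setCK card_part card_vertices; lia.
  apply: subset_leq_card; apply/subsetP => y; rewrite !inE => yz.
  by apply: s12; rewrite /r1 eq_sym.
have := H x; have := H (next (enum T) x); rewrite card_vertices => h1 h2.
have h3 : #|L| <= 2 * #|L|.-1 by lia.
have h4 : #|L| * m <= 2 * (#|L|.-1 * m) by rewrite mulnA leq_mul2r h3 orbT.
move=> H5.
have : #|nbr r2 x| + #|nbr r2 (next (enum T) x)| < #|L| * m.
  by apply: H5 => y; rewrite inE.
clear -h1 h2 h4; lia.
Qed.

End CompleteMultipartite.

(** * Existence of crossing neighbours *)

Section Crossing.

Variables (T L : finType) (e : rel T) (pt : T -> L) (m d : nat) (x0 : T).
Hypotheses (eC : symmetric e) (ept : forall x y, e x y -> pt x != pt y).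
Hypothesis card_part : forall l, #|[set x | pt x == l]| = m.
Hypothesis degd : forall x, d <= #|nbr e x|.

Lemma multipartite_irr : irreflexive e.
Proof. by move=> x; apply/negP => /ept; rewrite eqxx. Qed.

(** Each part has at most [#|D| - d] vertices in [D]: if [S] meets the part, a vertex of [S] there
    has [d] neighbours in [D] outside it; if not, [S] itself is a set of [d] vertices of [D] outside
    it. The claim is the sum over all parts. *)
Lemma closed_block (D S : {set T}) : S \subset D -> d <= #|S| ->
  {in S, forall x, nbr e x \subset D} -> #|L| * d + #|D| <= #|L| * #|D|.
Proof.
move=> SD dS HS.
have key l : #|[set x in D | pt x == l]| + d <= #|D|.
  have -> : [set x in D | pt x == l] = D :&: [set x | pt x == l].
    by apply/setP => x; rewrite !inE.
  rewrite -[leqRHS](cardsID [set x | pt x == l] D) leq_add2l.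
  have [u /andP[uS /eqP ul]|noS] := pickP [pred u in S | pt u == l].
    apply: leq_trans (degd u) _; apply: subset_leq_card; apply/subsetP => y yu.
    rewrite !inE (subsetP (HS u uS)) // andbT -ul.
    by move: yu; rewrite inE eq_sym => /ept.
  apply: leq_trans dS _; apply: subset_leq_card; apply/subsetP => y yS.
  by rewrite !inE (subsetP SD) // andbT; have := noS y; rewrite /= yS /= => ->.
rewrite -{1}(card_parts_sum pt D) addnC -[#|L| * d]sum_nat_const -big_split /=.
by rewrite -sum_nat_const; apply: leq_sum => l _.
Qed.

(** [q] is the stretch between the two crossing chords, and is exactly what the cycle [s1 ++ rev s2]
    misses. *)
Definition crossing s1 q s2 := [/\ s1 != [::], s2 != [::],
  spans (s1 ++ q ++ s2), sorted e (s1 ++ q ++ s2) &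
  e (head x0 s1) (head x0 s2) && e (last x0 s2) (last x0 s1)].

(* The induction moves the last neighbour of the head as far right as possible. *)
Lemma no_crossing_absurd d1 s2 :
  #|T| < 2 * d + m -> (forall s1 q s2, ~ crossing s1 q s2) ->
  spans (d1 ++ s2) -> sorted e (d1 ++ s2) -> d1 != [::] ->
  e (head x0 d1) (last x0 d1) -> False.
Proof.
move=> bd nocr.
have [N] := ubnP (#|T| - size d1); elim: N d1 s2 => // N IH d1 s2 le_N sp ps d1n ha.
(* Extremality, in a form that also covers rotated paths: a head neighbour beyond the first block
   would give a longer block. *)
have mx u1 u2 : u1 != [::] -> spans (u1 ++ u2) -> sorted e (u1 ++ u2) ->
    size d1 <= size u1 -> {in u2, forall z, ~~ e (head x0 u1) z}.
  move=> u1n spu pu su z zu; apply/negP => ez.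
  case/splitPr: zu spu pu => v1 v2; rewrite -cat_rcons catA => spu pu.
  apply: (IH _ _ _ spu pu); rewrite ?cat_nil_eq ?negb_and ?u1n //.
    have /andP[_ /eqP szu] := spu.
    move: szu le_N su; rewrite !size_cat size_rcons.
    by move: #|T| (size u1) (size v1) (size v2) (size d1) => *; lia.
  by rewrite head_cat_ne // last_cat last_rcons.
have [d0 [a Ed]] : exists d0 a, d1 = rcons d0 a.
  by case/lastP: (d1) d1n => // d0 a _; exists d0, a.
have la : last x0 d1 = a by rewrite Ed last_rcons.
(* A tail neighbour before [a] would cross the chord from the head to [a]. The end part [s2'] is
   arbitrary so that rotations of it are covered. *)
have nol s2' : s2' != [::] -> spans (d1 ++ s2') -> sorted e (d1 ++ s2') ->
    {in d0, forall z, ~~ e (last x0 s2') z}.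
  move=> sn sps pss z zd; apply/negP => ez.
  move: Ed; case/splitPr: zd => u1 u2; rewrite -cat_rcons => Ed.
  have [] := nocr (rcons u1 z) u2 (a :: s2').
  have E : d1 ++ s2' = rcons u1 z ++ u2 ++ a :: s2'.
    by rewrite Ed -cats1 -!catA.
  have rn : rcons u1 z != [::] by case: (u1).
  split; rewrite -?E // last_rcons; move: ha; rewrite la.
  have -> : last x0 (a :: s2') = last x0 s2' by case: (s2') sn.
  by rewrite Ed -cats1 -catA head_cat_ne // => ->.
have us : uniq (d1 ++ s2) by case/andP: sp.
pose s := d1 ++ s2.
(* Every vertex of [S] is the head of some rotated path, so all its neighbours
   lie in [d1]; symmetrically for the tails in [A2] below. *)
have A1 : #|L| * d + #|[set x in d1]| <= #|L| * #|[set x in d1]|.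
  pose S := [set prev s y | y in nbr e (head x0 d1)].
  have HS y : e (head x0 d1) y -> exists w1 c w2,
      [/\ d1 = w1 ++ c :: w2, w1 != [::], y = c & prev s y = last x0 w1].
    move=> ey.
    have yd : y \in d1.
      have := spans_mem y sp; rewrite mem_cat => /orP[//|ys2].
      by have := mx d1 s2 d1n sp ps (leqnn _) y ys2; rewrite ey.
    have yh : y != head x0 d1.
      by apply: contraTneq ey => ->; rewrite multipartite_irr.
    have [w1 [b [w2 E]]] := split_before yd yh.
    exists (rcons w1 b), y, w2; rewrite cat_rcons; split=> //.
      by case: (w1).
    rewrite last_rcons /s E -catA /=.
    rewrite -{2}(@next_adjacent _ w1 b y (w2 ++ s2)); last first.
      by move: us; rewrite E -catA.
    by rewrite prev_next //; move: us; rewrite E -catA.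
  apply: (@closed_block [set x in d1] S).
  - apply/subsetP => b /imsetP[y]; rewrite in_nbr => ey ->.
    have [w1 [c [w2 [E w1n _ ->]]]] := HS y ey.
    by rewrite inE E mem_cat last_in.
  - by rewrite card_imset ?degd //; apply: can_inj (next_prev us).
  move=> b /imsetP[y]; rewrite in_nbr => ey Eb.
  have [w1 [c [w2 [E w1n Ey Ep]]]] := HS y ey.
  apply/subsetP => z; rewrite !inE => bz; apply: contraT => zd.
  have zs2 : z \in s2 by have := spans_mem z sp; rewrite mem_cat (negPf zd).
  have := mx (rev w1 ++ c :: w2) s2 _ _ _ _ z zs2.
  rewrite head_cat_ne ?rev_nil_eq // head_rev -Ep -Eb bz; apply.
  - by rewrite cat_nil_eq negb_and rev_nil_eq w1n.
  - apply: spans_perm sp; rewrite E -!catA perm_sym.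
    by rewrite perm_cat2r perm_rev.
  - rewrite -catA; apply: (sorted_rotation (x0 := x0)) => //.
      by move: ps; rewrite E -catA.
    by rewrite -(head_cat_ne x0 (c :: w2) w1n) -E /= -Ey.
  - by rewrite E !size_cat size_rev.
(* If nothing follows [d1], its head is adjacent to its tail, which is a crossing with a single
   vertex in front and an empty gap. *)
have s2n : s2 != [::].
  apply/negP => /eqP s20; move: ha sp ps; rewrite s20 cats0.
  case: (d1) => [|x [|y p]] /=; rewrite ?multipartite_irr // => ha sp /andP[xy py].
  by have [] := nocr [:: x] [::] (y :: p); split; rewrite //= ?xy 1?eC.
have A2 : #|L| * d + #|[set x in a :: s2]| <= #|L| * #|[set x in a :: s2]|.
  pose l := last x0 s2.
  pose S := [set next s y | y in nbr e l].
  have Es : s = d0 ++ a :: s2 by rewrite /s Ed cat_rcons.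
  have HS y : e l y -> exists w1 b w2,
      [/\ a :: s2 = w1 ++ y :: b :: w2 & next s y = b].
    move=> ey.
    have yd : y \in a :: s2.
      have := spans_mem y sp; rewrite -/s Es mem_cat => /orP[yd0|//].
      by have := nol s2 s2n sp ps y yd0; rewrite ey.
    have yh : y != last x0 (a :: s2).
      apply: contraTneq ey => ->; rewrite -[a :: s2]/([:: a] ++ s2).
      by rewrite last_cat_ne // multipartite_irr.
    have [w1 [b [w2 E]]] := split_after yd yh.
    exists w1, b, w2; split=> //.
    by rewrite Es E catA next_adjacent // -catA -E -Es.
  apply: (@closed_block [set x in a :: s2] S).
  - apply/subsetP => b /imsetP[y]; rewrite in_nbr => ey ->.
    have [w1 [c [w2 [E ->]]]] := HS y ey.
    by rewrite inE E mem_cat !inE eqxx !orbT.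
  - by rewrite card_imset ?degd //; apply: can_inj (prev_next us).
  move=> b /imsetP[y]; rewrite in_nbr => ey Eb.
  have [w1 [c [w2 [E Ep]]]] := HS y ey.
  apply/subsetP => z; rewrite 2!inE => bz; apply: contraT => zd.
  have zd0 : z \in d0.
    by have := spans_mem z sp; rewrite -/s Es mem_cat (negPf zd) orbF.
  (* The tail is rotated at [y], so that the new tail is [c]. The rotated block still starts with
     [a], which [behead] drops because [d1] already ends with it. *)
  pose s2' := behead (w1 ++ y :: rev (c :: w2)).
  have E2 : a :: s2' = w1 ++ y :: rev (c :: w2).
    by move: E; rewrite /s2'; case: (w1) => [|a' w1'] /= [->].
  have s2'n : s2' != [::].
    move: (congr1 size E2); rewrite -size_eq0 /= size_cat /= size_rev /=; lia.
  have ls2 : last x0 s2' = c.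
    have -> : last x0 s2' = last x0 (a :: s2').
      by case: (s2') s2'n.
    by rewrite E2 last_cat /= rev_cons last_rcons.
  have Ed1 : d1 ++ s2' = d0 ++ w1 ++ y :: rev (c :: w2).
    by rewrite Ed cat_rcons E2.
  have Es' : d1 ++ s2 = (d0 ++ w1 ++ [:: y]) ++ c :: w2.
    by rewrite -/s Es E -!catA.
  have := nol s2' s2'n _ _ z zd0; rewrite ls2 -Ep -Eb bz; apply.
    apply: spans_perm sp; rewrite Ed1 -/s Es E !perm_cat2l perm_cons.
    by rewrite perm_sym perm_rev.
  have tn : d0 ++ w1 ++ [:: y] != [::] by case: (d0); case: (w1).
  rewrite Ed1 -[y :: rev _]/([:: y] ++ rev (c :: w2)) catA catA -(catA d0).
  move: ps; rewrite Es' (sorted_cat_ne x0) // => /and3P[p1 p2 p3].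
  rewrite (sorted_cat_ne x0) ?rev_nil_eq // sorted_rev_sym // p1 p2 head_rev.
  rewrite !last_cat /= eC.
  suff -> : last c w2 = l by [].
  have := congr1 (last x0) Es'; rewrite last_cat_ne // last_cat /= => <- //.
have D12 : #|[set x in d1]| + #|[set x in a :: s2]| = #|T|.+1.
  have ud : uniq d1 by move: us; rewrite cat_uniq => /and3P[].
  have ua : uniq (a :: s2).
    by move: us; rewrite Ed cat_rcons cat_uniq => /and3P[].
  move/card_uniqP: ud => ud; move/card_uniqP: ua => ua.
  rewrite !cardsE ud ua /=; have /andP[_ /eqP <-] := sp.
  by rewrite size_cat addnS.
(* With [k = #|L|], the two estimates add up to [2 k d <= (k - 1) (n + 1)]; as [n + 1 <= 2 d + m],
   this would give [n + 1 <= k m = n]. *)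
move: A1 A2 D12 bd; rewrite (card_vertices card_part); clear.
move: #|[set x in d1]| #|[set x in a :: s2]| #|L| => u v k; nia.
Qed.

End Crossing.

(** * A cycle missing one vertex *)

Section Shifts.

Variables (T : finType) (c : seq T).
Hypothesis uc : uniq c.

Let C := [set x in c].
Let f := next c.

(** The default in [head w p] is the wrap-around: with [p] empty the walk returns to [w]. *)
Lemma iter_next w r p : c = w :: r ++ p ->
  iter (size r).+1 f w = head w p.
Proof.
elim/last_ind: r p => [|r z IH] p E.
  rewrite /= /f; move: uc; rewrite E; case: p {E} => [|b p] u /=.
    by rewrite eqxx.
  by rewrite eqxx.
rewrite size_rcons iterS (IH (z :: p)) /=; last by rewrite E cat_rcons.
move: uc; rewrite /f E cat_rcons; case: p {E} => [|b p] u /=.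
  rewrite -[RHS]/(head w (w :: r ++ [:: z])) -next_last //.
  by rewrite /= last_cat.
by have := @next_adjacent _ (w :: r) z b p u.
Qed.

(** The vertices of the cycle form a single orbit of the successor map. *)
Lemma next_closed_full (B : {set T}) x : B \subset C -> x \in B ->
  f @: B \subset B -> B = C.
Proof.
move=> BC xB fB; apply/eqP; rewrite eqEsubset BC; apply/subsetP => y.
rewrite inE => yc.
have xc : x \in c by have := subsetP BC x xB; rewrite inE.
have fB' z : z \in B -> f z \in B.
  by move=> zB; apply: (subsetP fB); apply: imset_f.
have : fconnect f x y.
  by rewrite (fconnect_cycle (cycle_next uc) xc).
move/iter_findex => <-; elim: (findex _ _ _) => //= n; exact: fB'.
Qed.

(** The union of the iterated images of [N] under 1 to [j] successor steps. *)
Fixpoint shifts (N : {set T}) j :=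
  if j is i.+1 then f @: (N :|: shifts N i) else set0.

Lemma shifts_iter N j u : u \in shifts N j ->
  exists i w, [/\ 0 < i, i <= j, w \in N & u = iter i f w].
Proof.
elim: j u => [|j IH] u; first by rewrite inE.
case/imsetP=> v; rewrite inE => /orP[vN|/IH[i [w [i0 ij wN ->]]]] ->.
  by exists 1, v.
by exists i.+1, w.
Qed.

(** Two shifts of [N1] already cover [2 * #|N1|] vertices. Every further shift adds at least one,
    since otherwise the union would be closed under successors and fill the cycle, although it
    avoids the nonempty [N2]. *)
Lemma shift_growth (N1 N2 : {set T}) g : 1 < g ->
  N1 \subset C -> N2 \subset C -> N1 != set0 -> N2 != set0 ->
  [disjoint N1 & f @: N1] ->
  (forall i w, 0 < i <= g -> w \in N1 -> iter i f w \notin N2) ->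
  2 * #|N1| + g + #|N2| <= #|C| + 2.
Proof.
move=> g1 N1C N2C N1n N2n d1 d2.
have fi : injective f by apply: can_inj (prev_next uc).
have fC x : x \in C -> f x \in C by rewrite !inE mem_next.
have SC j : shifts N1 j \subset C.
  elim: j => [|j IH] /=; first exact: sub0set.
  apply/subsetP => _ /imsetP[v vN ->]; apply: fC.
  by case/setUP: vN; apply/subsetP.
have dS j : j <= g -> [disjoint shifts N1 j & N2].
  move=> jg; rewrite disjoint_subset; apply/subsetP => u.
  move=> /shifts_iter[i [w [i0 ij wN ->]]]; rewrite inE; apply: d2 => //.
  by rewrite i0 (leq_trans ij).
have mono j : shifts N1 j \subset shifts N1 j.+1.
  elim: j => [|j IH]; first exact: sub0set.
  by rewrite /=; apply: imsetS; apply: setUS.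
have [x xN] := set0Pn _ N1n; have [z zN] := set0Pn _ N2n.
have grow j : 2 <= j <= g -> 2 * #|N1| + j <= #|shifts N1 j| + 2.
  elim: j => // j IH /andP[j1 jg].
  have [->|j2] := eqVneq j 1.
    have := cardsUI N1 (f @: N1); rewrite (disjoint_setI0 d1) cards0 addn0.
    by rewrite /= setU0 !card_imset // => ->; lia.
  have lt : #|shifts N1 j| < #|shifts N1 j.+1|.
    apply: proper_card; rewrite properEneq mono andbT; apply/eqP => E.
    have jC : shifts N1 j = C.
      apply: (@next_closed_full _ (f x)) => //.
        rewrite E /=; apply: imset_f; by rewrite inE xN.
      have := imsetS f (subsetUr N1 (shifts N1 j)).
      by rewrite -[f @: (N1 :|: _)]/(shifts N1 j.+1) -E.
    have := disjointFl (dS j (ltnW jg)) zN.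
    by rewrite jC (subsetP N2C).
  have := IH; rewrite (ltnW jg) andbT; move: lt j1 j2; clear.
  move: #|_| #|_| #|_| => a b c'; lia.
have gg : 2 <= g <= g by rewrite g1 /=.
have := grow g gg.
have := cardsUI (shifts N1 g) N2.
rewrite (disjoint_setI0 (dS g (leqnn g))) cards0 addn0 => U.
have : #|shifts N1 g :|: N2| <= #|C|.
  by apply: subset_leq_card; rewrite subUset SC N2C.
rewrite U; move: #|C| #|N1| #|N2| #|shifts _ _|; clear; lia.
Qed.

End Shifts.

(** * Absorbing a path into a cycle *)

Section Absorption.

Variables (T : finType) (e : rel T) (d : nat) (x0 : T).
Hypotheses (eC : symmetric e) (eI : irreflexive e).
Hypothesis nh : ~~ hamb e.
Hypothesis degd : forall x, d <= #|nbr e x|.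

(** The path [q] takes the place of the segment [r], which becomes the new path left outside;
    [head u p] is [u] when nothing follows the segment. *)
Lemma replace_segment u r p q : q != [::] -> cycle e (u :: r ++ p) ->
  sorted e q -> e u (head x0 q) -> e (last x0 q) (head u p) ->
  cycle e (u :: q ++ p) /\ sorted e r.
Proof.
move=> qn; rewrite /= !rcons_cat !cat_path => /andP[pr pp] sq uq ql.
split; last by move: pr; apply: path_sorted.
case: q qn sq uq ql => //= a q _ -> -> ql /=.
by case: p pp ql => [|b p] /= => [_ ->|/andP[_ ->] ->].
Qed.

(** Off the cycle, the neighbours of [h] lie in [q] minus [h] itself. *)
Lemma card_nbr_path c q h : spans (c ++ q) -> h \in q ->
  #|nbr e h| < #|nbr e h :&: [set x in c]| + size q.
Proof.
move=> sp hq; rewrite -(cardsID [set x in c] (nbr e h)) ltn_add2l.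
have uq : uniq q by case/andP: sp; rewrite cat_uniq => /and3P[].
move/card_uniqP: (uq) => <-; apply: proper_card.
apply/properP; split; last by exists h; rewrite // !inE eI andbF.
apply/subsetP => y; rewrite !inE => /andP[yc _].
by have := spans_mem y sp; rewrite mem_cat (negPf yc).
Qed.

(** Induction on the length of [q]. If the head of [q] has two consecutive neighbours on [c], it is
    inserted between them. If a neighbour of the head is followed within [size q] steps by a
    neighbour of the tail, [q] is exchanged for the shorter segment between them. Otherwise
    [shift_growth] contradicts the degrees. *)
Lemma absorb_path c q : 2 * #|T| <= 5 * d -> c != [::] -> q != [::] ->
  cycle e c -> sorted e q -> spans (c ++ q) -> size q + 2 * d <= #|T| ->
  exists c' v, cycle e c' /\ spans (v :: c').
Proof.
move=> bd; have [N] := ubnP (size q); elim: N c q => // N IH c q.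
move=> le_N cn qn cc pq sp gb.
have [g1|g1] := leqP (size q) 1.
  case: q qn sp g1 {pq gb le_N} => [//|v [|//]] _ sp _.
  by exists c, v; split=> //; apply: spans_perm sp; rewrite perm_catC.
have uc : uniq c by case/andP: (sp); rewrite cat_uniq => /and3P[].
have uq : uniq q by case/andP: (sp); rewrite cat_uniq => /and3P[].
have dcq x : x \in c -> x \in q -> False.
  case/andP: (sp); rewrite cat_uniq => /and3P[_ /hasPn H _] _ xc xq.
  by have := H x xq; rewrite /= xc.
have szT : size c + size q = #|T|.
  by case/andP: (sp) => _ /eqP <-; rewrite size_cat.
pose C := [set x in c].
have cC : #|C| = size c by rewrite cardsE; apply/card_uniqP.
pose N1 := nbr e (head x0 q) :&: C; pose N2 := nbr e (last x0 q) :&: C.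
have b1 : d < #|N1| + size q.
  by apply: leq_ltn_trans (degd _) (card_nbr_path sp (head_in _ qn)).
have b2 : d < #|N2| + size q.
  by apply: leq_ltn_trans (degd _) (card_nbr_path sp (last_in _ qn)).
have [d1|nd1] := boolP [disjoint N1 & next c @: N1]; last first.
  move: nd1; rewrite -setI_eq0 => /set0Pn[v] /setIP[/setIP[hv _]].
  case/imsetP=> u /setIP[hu]; rewrite inE => uC Ev.
  have [i p Ep] := rot_to uC.
  have pe : perm_eq (u :: p) c by rewrite -Ep perm_rot.
  have up : uniq (u :: p) by rewrite -Ep rot_uniq.
  have vp : v = head u p.
    rewrite Ev -(next_rot i uc) Ep.
    by have := @iter_next _ _ up u [::] p erefl.
  have cp : cycle e (u :: [::] ++ p) by rewrite /= -/(cycle e (u :: p)) -Ep rot_cycle.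
  move: qn pq hv hu sp gb g1 le_N {uq dcq szT b1 b2 N1 N2}.
  case: q => [//|h [//|h' q]] _ /= /andP[_ pq] hv hu sp gb _ le_N.
  rewrite in_nbr in hv; rewrite in_nbr in hu.
  have [||cc' _] := @replace_segment u [::] p [:: h] isT cp isT.
  - by rewrite /= eC.
  - by rewrite /= -vp.
  apply: (IH (u :: [:: h] ++ p) (h' :: q)) => //; last by move: gb; rewrite /=; clear; lia.
  apply: spans_perm sp; rewrite -(permPl (perm_cat pe (perm_refl _))).
  by apply/permP => a; rewrite /= !count_cat /=; clear; lia.
have szc : size q <= size c by move: szT gb bd; clear; lia.
have [/forallP d2|] := boolP [forall w in N1, forall i : 'I_(size q),
    iter i.+1 (next c) w \notin N2].
  (* With [g = size q], both neighbour sets have at least [d + 1 - g] elements and [#|C| = n - g],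
     so the bound gives [3 d + 1 <= n + g <= 2 n - 2 d], against [2 n <= 5 d]. *)
  have := @shift_growth _ c uc N1 N2 (size q) g1 (subsetIr _ _) (subsetIr _ _).
  have n1 : N1 != set0 by rewrite -card_gt0; move: b1 gb bd; clear; lia.
  have n2 : N2 != set0 by rewrite -card_gt0; move: b2 gb bd; clear; lia.
  move/(_ n1 n2 d1); rewrite -/C cC => G.
  suff /G : forall i w, 0 < i <= size q -> w \in N1 ->
      iter i (next c) w \notin N2.
    by move: b1 b2 gb bd szT; clear; lia.
  move=> [//|i] w ig wN.
  by have /implyP/(_ wN)/forallP/(_ (Ordinal ig)) := d2 w.
case/forallPn=> w; rewrite negb_imply => /andP[wN].
case/forallPn=> -[i ig]; rewrite negbK -[iter _ _ _]/(iter i.+1 (next c) w) => wN2.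
have wc : w \in c by have := setIP wN => -[_]; rewrite inE.
have [k p Ep] := rot_to wc.
have pe : perm_eq (w :: p) c by rewrite -Ep perm_rot.
have up : uniq (w :: p) by rewrite -Ep rot_uniq.
pose r := take i p; pose p2 := drop i p.
have Er : p = r ++ p2 by rewrite cat_take_drop.
have sr : size r = i.
  rewrite size_take_min; apply/minn_idPl.
  by move: (perm_size pe) szc ig => /=; clear; lia.
have hit : iter i.+1 (next c) w = head w p2.
  rewrite -(@iter_next _ (w :: p) up w r p2) ?Er // sr.
  by apply: eq_iter => y; rewrite -Er -Ep next_rot.
have cp : cycle e (w :: r ++ p2) by rewrite -Er -Ep rot_cycle.
move: wN wN2; rewrite hit => /setIP[hw _] /setIP[hw2 _].
rewrite in_nbr eC in hw; rewrite in_nbr in hw2.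
have [cc' pr] := replace_segment qn cp pq hw hw2.
have sp' : spans ((w :: q ++ p2) ++ r).
  apply: spans_perm sp; rewrite -(permPl (perm_cat pe (perm_refl q))) Er.
  by apply/permP => a; rewrite /= !count_cat; clear; lia.
(* An empty segment means that all of [q] was inserted, which makes the cycle Hamiltonian. *)
have [r0|rn] := eqVneq r [::].
  case/negP: nh; apply/hambP; exists (w :: q ++ p2) => //.
  by move: sp'; rewrite r0 cats0.
apply: (IH (w :: q ++ p2) r) => //; rewrite sr.
  by move: ig le_N; clear; lia.
by move: ig gb; clear; lia.
Qed.

End Absorption.

(** * The hopping lemma *)

Section Hopping.

Variables (T : finType) (e : rel T) (c : seq T) (v : T).
Hypotheses (eC : symmetric e) (eI : irreflexive e).
Hypothesis nh : ~~ hamb e.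
Hypotheses (ec : cycle e c) (spc : spans (v :: c)) (cn : c != [::]).

Let uc : uniq c.
Proof. by case/andP: spc => /andP[]. Qed.

Definition sandwiched (X : {set T}) :=
  [set y in c | (prev c y \in X) && (next c y \in X)].

(** Along such edges a vertex of [sandwiched X] is met only from its two neighbours on [c], which
    both lie in [X]. *)
Definition hop_edge (X : {set T}) : rel T := fun a b => e a b &&
  [|| (a \notin sandwiched X) && (b \notin sandwiched X),
      b == next c a | a == next c b].

(** The last clause extends to [X] the fact that the ends of a Hamiltonian path of [c] are never
    both adjacent to [v]. *)
Definition hopset (X : {set T}) :=
  [/\ X \subset [set x in c], nbr e v \subset X,
      {in sandwiched X, forall y, nbr e y \subset X},
      {in X, forall a, next c a \notin X} &
      [disjoint X & sandwiched X] /\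
      forall s, perm_eq s c -> sorted (hop_edge X) s ->
        head v s \in X -> last v s \in X -> False].

Definition nbrs (S : {set T}) := [set z | [exists y in S, e y z]].

Lemma nbrsP (S : {set T}) z :
  reflect (exists2 y, y \in S & e y z) (z \in nbrs S).
Proof. by rewrite inE; apply: exists_inP. Qed.

Lemma nbrsS (S S' : {set T}) : S \subset S' -> nbrs S \subset nbrs S'.
Proof.
move=> SS; apply/subsetP => z /nbrsP[y yS yz]; apply/nbrsP; exists y => //.
exact: (subsetP SS).
Qed.

Lemma sandwichedS (X X' : {set T}) :
  X \subset X' -> sandwiched X \subset sandwiched X'.
Proof.
move=> XX; apply/subsetP => y; rewrite !inE => /and3P[-> p1 p2].
by rewrite !(subsetP XX).
Qed.

(* Woodall's alternating sets: starting from the vertex [v] missed by the cycle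
   [c], a vertex between two members of [hop l] can replace [v]. *)
Fixpoint hop l : {set T} :=
  if l is i.+1 then nbr e v :|: nbrs (sandwiched (hop i)) else set0.

Local Notation X := hop.
Local Notation Y l := (sandwiched (hop l)).

Lemma hop_le i j : i <= j -> X i \subset X j.
Proof.
elim: i j => [|i IH] [|j] //= ij; first exact: sub0set.
by apply: setUS; apply: nbrsS; apply: sandwichedS; apply: IH.
Qed.

(* Paths along [hop_rel] keep, at every vertex of a set [Y j], the property that
   makes rotations at that vertex end in [X j]. *)
Definition hop_rel l : rel T := fun a b => e a b &&
  [forall j : 'I_l, ((a \in Y j) ==> (b \in X j)) && ((b \in Y j) ==> (a \in X j))].

Lemma hop_relP l a b : reflect
  (e a b /\ forall j, j < l -> (a \in Y j -> b \in X j) /\ (b \in Y j -> a \in X j))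
  (hop_rel l a b).
Proof.
apply: (iffP andP) => -[-> H]; split=> //.
  by move=> j jl; have /forallP/(_ (Ordinal jl))/andP[/implyP ? /implyP ?] := H.
by apply/forallP => j; have [h1 h2] := H j (ltn_ord j); apply/andP; split; apply/implyP.
Qed.

Lemma hop_relC l : symmetric (hop_rel l).
Proof.
by move=> a b; apply/hop_relP/hop_relP => -[h1 h2]; rewrite eC; split=> // j /h2[].
Qed.

Lemma hop_rel_next l a : e a (next c a) -> hop_rel l a (next c a).
Proof.
move=> ea; apply/hop_relP; split=> // j _; rewrite !inE; split; first by case/and3P.
by case/and3P=> _; rewrite prev_next.
Qed.

Lemma hop_rel_cycle l : cycle (hop_rel l) c.
Proof.
apply: cycle_from_next => // x xc; apply: hop_rel_next.
exact: next_cycle.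
Qed.

Lemma swap_tail (r : rel T) A B : symmetric r -> A != [::] -> B != [::] ->
  cycle r (A ++ B) -> r (last v A) (last v B) -> sorted r (A ++ rev B).
Proof.
move=> rC An Bn; rewrite (cycle_sortedE v) ?cat_nil_eq ?(negPf An) //.
rewrite (sorted_cat_ne v) // => /andP[/and3P[pA pB _] _] ll.
by rewrite (sorted_cat_ne v) ?rev_nil_eq // sorted_rev_sym // head_rev pA pB.
Qed.

(** Cutting the cycle after [a] and after [b] prepares the exchanges in which one arc is reversed.
    The relation is quantified so that both [hop_rel] and [hop_edge] can be used. *)
Lemma swap_split a b : a \in c -> b \in c -> a != b ->
  exists A B, [/\ perm_eq (A ++ B) c, A != [::], B != [::],
     forall r, cycle r (A ++ B) = cycle r c &
     [/\ last v A = b, last v B = a, head v A = next c a & head v B = next c b]].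
Proof.
move=> ac bc ab; have [i p Ep] := rot_to ac.
have up : uniq (a :: p) by rewrite -Ep rot_uniq.
have bp : b \in p.
  by have := mem_rot i c b; rewrite Ep bc inE eq_sym (negPf ab).
case/splitPr: bp Ep up => p1 p2 Ep up.
exists (p1 ++ [:: b]), (p2 ++ [:: a]).
have Er : rot 1 (rot i c) = (p1 ++ [:: b]) ++ p2 ++ [:: a].
  by rewrite Ep rot1_cons -cats1 -!catA.
split.
- by rewrite -Er !perm_rot.
- by case: (p1).
- by case: (p2).
- by move=> r; rewrite -Er !rot_cycle.
split; rewrite ?last_cat //.
  rewrite -(next_rot i uc) Ep; case: (p1) => [|z q] /=; by rewrite eqxx.
rewrite -(next_rot i uc) Ep; move: up.
case: p2 {Ep Er} => [|z q] up; last first.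
  by rewrite -[a :: _ ++ _]/((a :: p1) ++ b :: z :: q) next_adjacent.
rewrite -[LHS]/(head v (a :: p1 ++ [:: b])) -next_last //.
by rewrite /= last_cat.
Qed.

(** The invariant carried along the construction of [hop]. *)
Definition hop_free l := forall s, perm_eq s c -> sorted (hop_rel l) s ->
  head v s \in X l -> last v s \in X l -> False.

(** Cutting the cycle between two consecutive vertices of [X l] would give a forbidden path. *)
Lemma hop_free_next l a : hop_free l ->
  a \in c -> a \in X l -> next c a \in X l -> False.
Proof.
move=> Tl ac aX nX.
have nc : next c a \in c by rewrite mem_next.
have [i p Ep] := rot_to nc.
have up : uniq (next c a :: p) by rewrite -Ep rot_uniq.
apply: (Tl (next c a :: p)) => //.
- by rewrite -Ep perm_rot.
- by have := hop_rel_cycle l; rewrite -(rot_cycle i) Ep /= rcons_path => /andP[].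
- by rewrite /= -prev_head // -Ep prev_rot // prev_next.
Qed.

(** Such an [a] would be adjacent to some [y] in [Y l], and the chord [a y] would turn the cycle
    into a path from the successor of [a] to the successor of [y], both in [X l]. *)
Lemma hop_free_disjoint l a : hop_free l -> a \in X l.+1 -> a \in Y l -> False.
Proof.
move=> Tl aX aY.
have [ac naX] : a \in c /\ next c a \in X l by move: aY; rewrite inE => /and3P[].
have aXl : a \notin X l by apply/negP => /(hop_free_next Tl ac)/(_ naX).
case/setUP: aX => [av|/nbrsP[y yY ya]].
  case: l aY aXl {Tl naX} => [|l] aY aXl; first by move: aY; rewrite inE /= !inE /= andbF.
  by move/negP: aXl; apply; rewrite /= in_setU av.
have [yc nyX] : y \in c /\ next c y \in X l by move: yY; rewrite inE => /and3P[].
have yXl : y \notin X l by apply/negP => /(hop_free_next Tl yc)/(_ nyX).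
have ay : a != y by apply: contraTneq ya => ->; rewrite eI.
have [A [B [pAB An Bn rAB [lA lB hA hB]]]] := swap_split ac yc ay.
(* Neither end of the chord lies in an earlier [Y j], since the other end would then be in [X l];
   hence the chord is a [hop_rel l] edge. *)
have up j x y' : j < l -> x \in Y j -> e x y' -> y' \in X l.
  move=> jl xY xy; apply: (subsetP (hop_le jl)); rewrite /= in_setU; apply/orP; right.
  by apply/nbrsP; exists x.
apply: (Tl (A ++ rev B)).
- by apply: perm_trans pAB; rewrite perm_cat2l perm_rev.
- apply: swap_tail => //; first exact: hop_relC.
    by rewrite rAB hop_rel_cycle.
  rewrite lA lB; apply/hop_relP; split=> // j jl; split=> H.
    by have := up _ _ _ jl H ya; rewrite (negPf aXl).
    by have := up j a y jl H; rewrite eC => /(_ ya); rewrite (negPf yXl).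
- by rewrite head_cat_ne // hA.
- by rewrite last_cat_ne ?rev_nil_eq // last_rev hB.
Qed.

(** At level 1 the set is the neighbourhood of [v], and a path with both ends there closes up
    through [v]. *)
Lemma hop_free1 : hop_free 1.
Proof.
have Y0 : nbrs (Y 0) = set0.
  by apply/setP => z; apply/nbrsP; rewrite inE => -[y]; rewrite inE /= !inE /= andbF.
move=> s ps rs; rewrite /= Y0 setU0 !in_nbr => hs ls.
case/negP: nh; apply/hambP; exists (v :: s); last first.
  by apply: spans_perm spc; rewrite perm_cons perm_sym.
have sn : s != [::] by rewrite -size_eq0 (perm_size ps) size_eq0.
have se : sorted e s by apply: sub_sorted rs => a b /hop_relP[].
case: s sn hs ls se {ps rs} => //= a s _ va la pa.
by rewrite va rcons_path pa eC.
Qed.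

(** An end of the path new in [X l.+1] is adjacent to some [y] in [Y l]. Rotating there makes a path
    neighbour of [y] the new end, and [hop_rel l.+1] puts it in [X l]. The head is treated first,
    then the tail. *)
Lemma hop_free_step l : 0 < l -> hop_free l -> hop_free l.+1.
Proof.
move=> l0 Tl s ps rs hs ls.
have sn : s != [::] by rewrite -size_eq0 (perm_size ps) size_eq0.
have from a : a \in X l.+1 -> a \notin X l -> exists2 y, y \in Y l & e y a.
  case/setUP => [av|/nbrsP //]; case: (l) l0 => // l' _.
  by rewrite /= in_setU av.
have disj a : a \in X l.+1 -> a \notin Y l.
  by move=> aX; apply/negP; apply: hop_free_disjoint Tl aX.
have new y b : y \in Y l -> e y b -> b \in X l.+1 -> b \notin X l -> hop_rel l y b.
  move=> yY yb bX nbX; apply/hop_relP; split=> // j jl; split=> H.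
    case/negP: nbX; apply: (subsetP (hop_le jl)); rewrite /= in_setU; apply/orP; right.
    by apply/nbrsP; exists y.
  case/negP: (disj b bX); apply: subsetP H.
  by apply: sandwichedS; apply: hop_le; apply: ltnW.
have sub a b : hop_rel l.+1 a b -> hop_rel l a b.
  by case/hop_relP=> h1 h2; apply/hop_relP; split=> // j jl; apply: h2; apply: ltnW.
(* The half of the condition at level [l] that survives the first rotation: the new edge enters [y]
   from the old head, which is not in [Y l], so successors of vertices of [Y l] remain in [X l]. *)
pose q : rel T := fun a b => hop_rel l a b && ((a \in Y l) ==> (b \in X l)).
have subq a b : hop_rel l.+1 a b -> q a b.
  move=> h; rewrite /q sub //=; apply/implyP.
  by case/hop_relP: h => _ /(_ l (leqnn _))[].
have [s1 [ps1 qs1 hs1 ls1]] : exists s1, [/\ perm_eq s1 c, sorted q s1,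
    head v s1 \in X l & last v s1 \in X l.+1].
  have [hX|hX] := boolP (head v s \in X l).
    by exists s; split=> //; apply: sub_sorted rs.
  have [y yY yh] := from _ hs hX.
  have ys : y \in s by rewrite (perm_mem ps); move: yY; rewrite inE => /and3P[].
  have yn : y != head v s by apply: contraTneq yh => ->; rewrite eI.
  have [t1 [z [t2 Es]]] := split_before ys yn.
  have Es' : s = (t1 ++ [:: z]) ++ y :: t2 by rewrite Es -catA.
  have tn : t1 ++ [:: z] != [::] by case: (t1).
  move: rs; rewrite Es' (sorted_cat_ne v) // => /and3P[r1 r2].
  rewrite last_cat /= => /hop_relP[_ /(_ l (leqnn _))[_ /(_ yY) zX]].
  exists (rev (t1 ++ [:: z]) ++ y :: t2); split.
  - by apply: perm_trans ps; rewrite Es' perm_cat2r perm_rev.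
  - rewrite (sorted_cat_ne v) ?rev_nil_eq // last_rev.
    rewrite (sub_sorted subq) ?(sub_sorted subq) ?sorted_rev_sym //=; last exact: hop_relC.
    have hE : head v (t1 ++ [:: z]) = head v s by rewrite Es' [RHS]head_cat_ne.
    by rewrite hE /q hop_relC (new y _ yY yh hs hX) (negPf (disj _ hs)).
  - by rewrite head_cat_ne ?rev_nil_eq // head_rev last_cat.
  - by rewrite last_cat_ne //; move: ls; rewrite Es' last_cat_ne.
have sub1 : subrel q (hop_rel l) by move=> a b /andP[].
have [lX|lX] := boolP (last v s1 \in X l).
  by apply: (Tl s1) => //; apply: sub_sorted qs1.
have [y yY yh] := from _ ls1 lX.
have ys : y \in s1 by rewrite (perm_mem ps1); move: yY; rewrite inE => /and3P[].
have yn : y != last v s1 by apply: contraTneq yh => ->; rewrite eI.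
have [t1 [z [t2 Es]]] := split_after ys yn.
have Es' : s1 = (t1 ++ [:: y]) ++ z :: t2 by rewrite Es -catA.
have tn : t1 ++ [:: y] != [::] by case: (t1).
move: (qs1); rewrite Es' (sorted_cat_ne v) // => /and3P[r1 r2].
rewrite last_cat /= => /andP[_]; rewrite yY /= => zX.
apply: (Tl ((t1 ++ [:: y]) ++ rev (z :: t2))).
- by apply: perm_trans ps1; rewrite Es' perm_cat2l perm_rev.
- rewrite (sorted_cat_ne v) ?rev_nil_eq // head_rev.
  rewrite sorted_rev_sym; last exact: hop_relC.
  rewrite !(sub_sorted sub1) //= last_cat /=.
  have -> : last z t2 = last v s1 by rewrite Es' last_cat.
  exact: new.
- by rewrite head_cat_ne //; move: hs1; rewrite Es' head_cat_ne.
- by rewrite last_cat_ne ?rev_nil_eq // last_rev.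
Qed.

Lemma hop_free_all l : hop_free l.
Proof.
case: l => [|l]; first by move=> s _ _; rewrite inE.
by elim: l => [|l IH]; [exact: hop_free1 | exact: hop_free_step].
Qed.

Lemma hop_stable : exists l, X l.+1 = X l.
Proof.
suff H n : (exists l, X l.+1 = X l) \/ n <= #|X n|.
  by case: (H #|T|.+1) => // h; have := leq_trans h (max_card _); rewrite ltnn.
elim: n => [|n [IH|IH]]; [by right | by left |].
have [E|E] := eqVneq (X n.+1) (X n); first by left; exists n.
right; apply: leq_ltn_trans IH _; apply: proper_card.
by rewrite properEneq eq_sym E hop_le.
Qed.

(* Woodall's hopping lemma. *)
Lemma hopping : exists X : {set T}, hopset X.
Proof.
have [l Xl] := hop_stable; exists (X l); have Tl := hop_free_all (l := l).
have NvX : nbr e v \subset X l by rewrite -Xl /=; apply: subsetUl.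
have dis a : a \in X l -> a \in Y l -> False.
  by rewrite -{1}Xl; apply: hop_free_disjoint.
have NyX : {in Y l, forall y, nbr e y \subset X l}.
  move=> y yY; apply/subsetP => z; rewrite in_nbr => yz; rewrite -Xl /= in_setU.
  by apply/orP; right; apply/nbrsP; exists y.
have XC : X l \subset [set x in c].
  apply/subsetP => x xX; rewrite inE; have := spans_mem x spc; rewrite inE.
  case/orP => // /eqP xv; move: xX; rewrite xv -Xl => /setUP[|/nbrsP[y yY yv]].
    by rewrite in_nbr eI.
  case: (dis y) => //; apply: (subsetP NvX).
  by rewrite in_nbr eC.
split=> //.
  move=> a aX; apply/negP => naX; apply: (hop_free_next Tl _ aX naX).
  by have := subsetP XC a aX; rewrite inE.
split; first by rewrite disjoint_subset; apply/subsetP => a /dis h; apply/negP.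
move=> s ps rs; apply: Tl => //; apply: sub_sorted rs => a b /andP[ab].
case/or3P => [/andP[na nb]|/eqP bE|/eqP aE].
- apply/hop_relP; split=> // j jl.
  have sY : Y j \subset Y l by apply: sandwichedS; apply: hop_le; apply: ltnW.
  by split=> /(subsetP sY) H; [rewrite H in na | rewrite H in nb].
- by rewrite bE; apply: hop_rel_next; rewrite -bE.
- by rewrite hop_relC aE; apply: hop_rel_next; rewrite -aE eC.
Qed.

End Hopping.

(** * Edge exchanges around a hopping set *)

Section HopStructure.

Variables (T : finType) (e : rel T) (c : seq T) (v : T) (X : {set T}).
Hypotheses (eC : symmetric e) (eI : irreflexive e).
Hypotheses (ec : cycle e c) (spc : spans (v :: c)).
Hypothesis HX : hopset e c v X.

Local Notation Y := (sandwiched c X).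

Lemma spans_cons_uniq : uniq c.
Proof. by case/andP: spc => /andP[]. Qed.

Let uc := spans_cons_uniq.

Lemma hop_sub x : x \in X -> x \in c.
Proof. by case: HX => XC _ _ _ _ /(subsetP XC); rewrite inE. Qed.

Lemma hop_next x : x \in X -> next c x \notin X.
Proof. by case: HX => _ _ _ H _; apply: H. Qed.

Lemma hop_prev x : x \in X -> prev c x \notin X.
Proof. by move=> xX; apply/negP => /hop_next; rewrite next_prev // xX. Qed.

Lemma hop_nbr_v x : e v x -> x \in X.
Proof. by case: HX => _ /subsetP H _ _ _ vx; apply: H; rewrite in_nbr. Qed.

Lemma hop_nbr_Y y x : y \in Y -> e y x -> x \in X.
Proof. by case: HX => _ _ H _ _ /H/subsetP h yx; apply: h; rewrite in_nbr. Qed.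

Lemma hop_disjoint x : x \in X -> x \notin Y.
Proof. by case: HX => _ _ _ _ [/disjointFr D _] /D ->. Qed.

Lemma hop_free_path s : perm_eq s c -> sorted (hop_edge e c X) s ->
  head v s \in X -> last v s \in X -> False.
Proof. by case: HX => _ _ _ _ [_]; apply. Qed.

Lemma hop_edge_sym : symmetric (hop_edge e c X).
Proof.
move=> a b; rewrite /hop_edge eC; congr (_ && _).
by rewrite andbC; congr (_ || _); rewrite orbC.
Qed.

Lemma hop_edge_cycle : cycle (hop_edge e c X) c.
Proof.
apply: cycle_from_next => // x xc; rewrite /hop_edge eqxx orbT andbT.
exact: next_cycle.
Qed.

Lemma hop_edge_avoid a b :
  e a b -> a \notin Y -> b \notin Y -> hop_edge e c X a b.
Proof. by rewrite /hop_edge => -> -> ->. Qed.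

(** An edge between the two successors, with one arc reversed, gives a path from [b] to [a]. It
    avoids [Y], because vertices of [Y] have all their neighbours in [X] and successors of [X] are
    outside [X]. *)
Lemma hop_next_indep a b : a \in X -> b \in X -> ~~ e (next c a) (next c b).
Proof.
move=> aX bX; apply/negP => eab.
have ab : a != b by apply: contraTneq eab => ->; rewrite eI.
have [A [B [pAB An Bn rAB [lA lB hA hB]]]] := swap_split spc (hop_sub aX) (hop_sub bX) ab.
apply: (hop_free_path (s := rev A ++ B)).
- by apply: perm_trans pAB; rewrite perm_cat2r perm_rev.
- have := hop_edge_cycle; rewrite -rAB (cycle_sortedE v) ?cat_nil_eq ?(negPf An) //.
  rewrite (sorted_cat_ne v) // => /andP[/and3P[pA pB _] _].
  rewrite (sorted_cat_ne v) ?rev_nil_eq // sorted_rev_sym; last exact: hop_edge_sym.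
  rewrite pA pB /= last_rev hA hB; apply: hop_edge_avoid => //; apply/negP => h.
    by case/negP: (hop_next bX); apply: hop_nbr_Y h eab.
  by case/negP: (hop_next aX); apply: hop_nbr_Y h _; rewrite eC.
- by rewrite head_cat_ne ?rev_nil_eq // head_rev lA.
- by rewrite last_cat_ne // lB.
Qed.

Lemma hop_successors_indep w z :
  w \in next c @: X -> z \in v |: next c @: X -> ~~ e w z.
Proof.
case/imsetP=> a aX -> /setU1P[->|/imsetP[b bX ->]]; last exact: hop_next_indep.
by apply/negP => h; case/negP: (hop_next aX); apply: hop_nbr_v; rewrite eC.
Qed.

(* With [c = w q1 b q2 w' p2] and [b] the first vertex of [X] after [w], the
   forbidden path is [b q2 w' (rev q1) w p2]. *)
Lemma hop_same_nbrs_absurd w w' (S : {set T}) :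
  w \in next c @: X -> w' \in next c @: X -> w != w' ->
  w \notin Y -> w' \notin Y -> nbr e w = S -> nbr e w' = S ->
  {in c, forall z, z \notin X -> z \notin next c @: X -> z \in S} -> False.
Proof.
move=> wN wN' ww wY wY' Sw Sw' HS.
have NX z : z \in next c @: X -> prev c z \in X /\ z \notin X.
  by case/imsetP=> a aX ->; rewrite prev_next // hop_next.
have [[pw wX] [pw' wX']] := (NX w wN, NX w' wN').
have wc : w \in c by rewrite -(mem_prev c); apply: hop_sub.
have wc' : w' \in c by rewrite -(mem_prev c); apply: hop_sub.
have avoid u z : u \notin X -> e u z -> z \notin Y.
  by move=> uX uz; apply/negP => zY; case/negP: uX; apply: hop_nbr_Y zY _; rewrite eC.
have [i p Ep] := rot_to wc.
have up : uniq (w :: p) by rewrite -Ep rot_uniq.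
have pE : prev c =1 prev (w :: p) by move=> z; rewrite -Ep prev_rot.
have nE : next c =1 next (w :: p) by move=> z; rewrite -Ep next_rot.
have w'p : w' \in p.
  by have := mem_rot i c w'; rewrite Ep wc' inE eq_sym (negPf ww).
case/splitPr: w'p Ep up pE nE => p1 p2 Ep up pE nE.
have hp1 : has [in X] p1.
  case/lastP: p1 Ep up pE {nE} => [|p1 a] Ep up pE.
    by have := @prev_adjacent _ [::] w w' p2 up; rewrite -pE => E; rewrite -E pw' in wX.
  apply/hasP; exists a; first by rewrite mem_rcons mem_head.
  suff <- : prev c w' = a by [].
  move: up pE; rewrite cat_rcons -cat_cons => up pE.
  by rewrite pE (@prev_adjacent _ (w :: p1)).
case/split_find: hp1 Ep up pE nE => b q1 q2 /= bX nq1 Ep up pE nE.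
have q1X z : z \in q1 -> z \notin X by move=> zq; apply: contra nq1 => zX; apply/hasP; exists z.
(* Otherwise [w] would lie between two members of [X]. *)
have q1n : q1 != [::].
  apply: contraNneq wY => q10; rewrite inE wc pw /=.
  suff -> : next c w = b by [].
  by rewrite nE q10 /= eqxx.
have p2n : p2 != [::].
  apply: contraNneq wX' => p20; suff <- : prev c w = w' by [].
  by rewrite pE prev_head // p20 last_cat.
have [q0 [z Eq1]] : exists q0 z, q1 = rcons q0 z.
  by case/lastP: (q1) q1n => // q0 z _; exists q0, z.
(* Neither [z], the last vertex of [q1], nor its predecessor is in [X], so [z] belongs to the common
   neighbourhood [S]. *)
have zw' : e w' z.
  have zq1 : z \in q1 by rewrite Eq1 mem_rcons mem_head.
  rewrite -in_nbr Sw'; apply: HS.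
  - by rewrite -(mem_rot i) Ep inE !mem_cat mem_rcons inE zq1 !orbT.
  - exact: q1X.
  apply/negP => /NX[pz _]; move: pz.
  move: up; rewrite pE Eq1 -catA !cat_rcons.
  case/lastP: (q0) Eq1 => [|q3 a] Eq1 up.
    by rewrite (@prev_adjacent _ [::]) // (negPf wX).
  move: up; rewrite cat_rcons => up.
  by rewrite (@prev_adjacent _ (w :: q3)) // (negPf (q1X _ _)) //
    Eq1 mem_rcons inE mem_rcons mem_head orbT.
have nw' : next c w' = head w p2.
  rewrite nE; case: p2 p2n up {Ep pE nE} => // h p2 _ up.
  exact: (@next_adjacent _ (w :: (rcons q1 b ++ q2))) up.
(* The cycle edge leaving [w'] transfers to [w] through the common neighbourhood. *)
have wh : e w (head w p2).
  by rewrite -in_nbr Sw -Sw' in_nbr -nw'; apply: next_cycle.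
pose A := w :: q1; pose B := b :: q2 ++ [:: w'].
have Ec : rot i c = A ++ B ++ p2.
  by rewrite Ep /A /B cat_cons -cats1 -!catA /= -catA.
apply: (hop_free_path (s := B ++ rev A ++ p2)).
- apply: (@perm_trans _ (A ++ B ++ p2)); last by rewrite -Ec perm_rot.
  by rewrite !catA perm_cat2r perm_catC perm_cat2r perm_rev.
- have := hop_edge_cycle; rewrite -(rot_cycle i) Ec.
  have [An Bn] : A != [::] /\ B != [::] by [].
  rewrite (cycle_sortedE v) ?cat_nil_eq ?(negPf An) //.
  rewrite (sorted_cat_ne v) ?cat_nil_eq ?(negPf Bn) // (sorted_cat_ne v) //.
  case/andP=> /and3P[pA /and3P[pB p2s _] _] _.
  rewrite (sorted_cat_ne v) ?cat_nil_eq ?rev_nil_eq ?(negPf An) //.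
  rewrite (sorted_cat_ne v) ?rev_nil_eq // sorted_rev_sym; last exact: hop_edge_sym.
  rewrite pA pB p2s /= last_rev head_cat_ne ?rev_nil_eq // head_rev /A.
  rewrite last_cat /= Eq1 last_rcons.
  have -> : head v p2 = head w p2 by case: (p2) p2n.
  rewrite !hop_edge_avoid //.
    exact: avoid wX' zw'.
  exact: avoid wX wh.
- by [].
- rewrite !last_cat_ne ?cat_nil_eq ?negb_and ?p2n ?orbT //.
  suff -> : last v p2 = prev c w by [].
  rewrite pE prev_head // last_cat; by case: (p2) p2n.
Qed.

(** Reversing the cycle exchanges successors and predecessors, so results on successors carry
    over. *)
Lemma hopset_rev : hopset e (rev c) v X.
Proof.
have sE : sandwiched (rev c) X = Y.
  apply/setP => y; rewrite !inE mem_rev prev_rev // next_rev //.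
  by rewrite [X in _ && X]andbC.
split.
- by apply/subsetP => x /hop_sub; rewrite inE mem_rev.
- by apply/subsetP => x; rewrite in_nbr => /hop_nbr_v.
- by move=> y; rewrite sE => yY; apply/subsetP => x; rewrite in_nbr; apply: hop_nbr_Y.
- by move=> a aX; rewrite next_rev // hop_prev.
rewrite sE; split.
  by rewrite disjoint_subset; apply/subsetP => x /hop_disjoint.
move=> s ps rs; apply: hop_free_path; first by apply: perm_trans ps _; rewrite perm_rev.
apply: sub_sorted rs => a b; rewrite /hop_edge sE => /andP[-> /or3P[->//|/eqP->|/eqP->]] /=.
  by rewrite next_rev // next_prev // eqxx !orbT.
by rewrite next_rev // next_prev // eqxx !orbT.
Qed.

End HopStructure.

(** * Counting *)

Lemma card_parts_in (T L : finType) (pt : T -> L) (D : {set T}) (S : {set L}) :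
  #|[set w in D | pt w \in S]| = \sum_(l in S) #|[set w in D | pt w == l]|.
Proof.
rewrite -sum1_card (partition_big pt [in S]) /=; last by move=> w; rewrite inE => /andP[].
apply: eq_bigr => l lS; rewrite -sum1_card; apply: eq_bigl => w; rewrite !inE.
by rewrite -andbA; congr (_ && _); apply: andb_idl => /eqP->.
Qed.

Section HopCounting.

Variables (T L : finType) (e : rel T) (pt : T -> L) (m d : nat).
Hypotheses (eC : symmetric e) (ept : forall x y, e x y -> pt x != pt y).
Hypothesis card_part : forall l, #|[set x | pt x == l]| = m.
Hypothesis degd : forall x, d <= #|nbr e x|.
Variables (c : seq T) (v : T) (X : {set T}).
Hypotheses (ec : cycle e c) (spc : spans (v :: c)).
Hypothesis HX : hopset e c v X.

Local Notation Y := (sandwiched c X).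
Local Notation P := (next c @: X).
Local Notation Q := (prev c @: X).

Let eI := multipartite_irr ept.
Let uc := spans_cons_uniq spc.

Definition hop_parts := pt @: (v |: sandwiched c X).
Local Notation SL := hop_parts.
Local Notation W := [set w | pt w \notin SL].

Lemma in_succ y : (y \in P) = (prev c y \in X).
Proof.
apply/imsetP/idP => [[a aX ->]|h]; first by rewrite prev_next.
by exists (prev c y); rewrite // next_prev.
Qed.

Lemma in_pred y : (y \in Q) = (next c y \in X).
Proof.
apply/imsetP/idP => [[a aX ->]|h]; first by rewrite next_prev.
by exists (next c y); rewrite // prev_next.
Qed.

Lemma card_succ : #|P| = #|X|.
Proof. by apply: card_imset; apply: can_inj (prev_next uc). Qed.

Lemma v_notin_c : v \notin c.
Proof. by case/andP: spc => /andP[]. Qed.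

Lemma succ_pred_cap : P :&: Q = Y.
Proof.
apply/setP => y; rewrite in_setI in_succ in_pred inE; case yc: (y \in c) => //=.
apply/negP => /andP[/(hop_sub HX)]; by rewrite mem_prev yc.
Qed.

Lemma card_succ_pred : #|P :|: Q| + #|Y| = 2 * #|X|.
Proof.
rewrite -succ_pred_cap cardsUI card_succ card_imset; first by lia.
exact: can_inj (next_prev uc).
Qed.

(** As [X] has no consecutive vertices, it is disjoint from [P :|: Q]; the strict inequality
    accounts for [v]. *)
Lemma card_outside (Z : {set T}) : v \notin Z -> [disjoint Z & P :|: Q] ->
  [disjoint Z & X] -> #|Z| + #|P :|: Q| + #|X| < #|T|.
Proof.
move=> vZ dZ dX.
have dPX : [disjoint P :|: Q & X].
  rewrite disjoint_subset; apply/subsetP => y; rewrite in_setU => /orP[]/imsetP[a aX ->];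
  by rewrite inE ?(hop_next HX) ?(hop_prev spc HX).
have d2 : [disjoint Z :|: (P :|: Q) & X].
  rewrite disjoint_subset; apply/subsetP => y; rewrite in_setU => /orP[] h; rewrite inE.
    by rewrite (disjointFr dX h).
  by rewrite (disjointFr dPX h).
have U1 := cardsUI Z (P :|: Q); rewrite (disjoint_setI0 dZ) cards0 addn0 in U1.
have U2 := cardsUI (Z :|: (P :|: Q)) X; rewrite (disjoint_setI0 d2) cards0 addn0 in U2.
rewrite -U1 -U2 -cardsT; apply: proper_card; apply/properP; split; first exact/subsetP.
exists v; first by rewrite in_setT.
have vX : v \notin X by apply/negP => /(hop_sub HX); rewrite (negPf v_notin_c).
rewrite !in_setU (negPf vZ) (negPf vX) in_succ in_pred orbF /=; apply/negP.
by case/orP => /(hop_sub HX); rewrite ?mem_prev ?mem_next (negPf v_notin_c).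
Qed.

Lemma card_hop_lt : 2 * #|X| < #|T|.
Proof.
have := card_outside (Z := set0); rewrite inE cards0 add0n => /(_ isT).
rewrite !disjoints_subset !sub0set => /(_ isT isT).
have := subset_leq_card (subsetUl P Q); rewrite card_succ; lia.
Qed.

Lemma card_sandwiched : 3 * #|X| < #|T| + #|Y|.
Proof.
have := card_outside (Z := set0); rewrite inE cards0 add0n => /(_ isT).
rewrite !disjoints_subset !sub0set => /(_ isT isT).
by have := card_succ_pred; lia.
Qed.

Lemma nbr_hop y : y \in v |: Y -> nbr e y \subset X.
Proof.
case/setU1P => [->|yY]; apply/subsetP => z; rewrite in_nbr.
  exact: (hop_nbr_v HX).
exact: (hop_nbr_Y HX).
Qed.

Lemma degree_le_hop : d <= #|X|.
Proof.
apply: leq_trans (degd v) _; apply: subset_leq_card; apply: nbr_hop.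
exact: setU11.
Qed.

(** A vertex of [v |: Y] in the part has its [d] neighbours in [X], all outside that part. *)
Lemma card_hop_part l : l \in SL -> #|[set w in X | pt w == l]| + d <= #|X|.
Proof.
case/imsetP=> y yY ->.
rewrite -[leqRHS](cardsID [set w | pt w == pt y] X).
have -> : [set w in X | pt w == pt y] = X :&: [set w | pt w == pt y].
  by apply/setP => w; rewrite !inE.
rewrite leq_add2l; apply: leq_trans (degd y) _; apply: subset_leq_card.
apply/subsetP => z yz; rewrite !inE (subsetP (nbr_hop yY)) // andbT.
by move: yz; rewrite in_nbr eq_sym => /ept.
Qed.

Lemma card_hop_in_parts : #|[set w in X | pt w \in SL]| + #|SL| * d <= #|SL| * #|X|.
Proof.
rewrite card_parts_in -!sum_nat_const -big_split /=.
by apply: leq_sum => l; apply: card_hop_part.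
Qed.

Lemma card_in_parts (S : {set L}) : #|[set w | pt w \in S]| = #|S| * m.
Proof.
have := card_parts_in pt [set: T] S; rewrite -sum_nat_const => E.
transitivity #|[set w in [set: T] | pt w \in S]|; first by apply: eq_card => w; rewrite !inE.
rewrite E; apply: eq_bigr => l _; rewrite -(card_part l).
by apply: eq_card => w; rewrite !inE.
Qed.

Lemma card_W : #|W| + #|SL| * m = #|L| * m.
Proof.
rewrite -card_in_parts -(card_vertices card_part) -(cardsC [set w | pt w \in SL]) addnC.
by congr (_ + _); apply: eq_card => w; rewrite !inE.
Qed.

Lemma card_hop_W : #|[set w in X | pt w \in SL]| + #|W :&: X| = #|X|.
Proof.
rewrite -(cardsID [set w | pt w \in SL] X); congr (_ + _).
  by apply: eq_card => w; rewrite !inE.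
by apply: eq_card => w; rewrite !inE.
Qed.

(** With [s = #|SL|], at most [s (#|X| - d)] vertices of [X] lie in the parts met by [v |: Y], and
    the other parts have only [n - s m] vertices. *)
Lemma card_hop_le : #|X| + #|SL| * (m + d) <= #|T| + #|SL| * #|X|.
Proof.
have := card_hop_in_parts; have := card_hop_W; have := card_W.
have : #|W :&: X| <= #|W| by apply: subset_leq_card; apply: subsetIl.
rewrite (card_vertices card_part) mulnDr; clear.
move: #|_| #|_| (#|SL| * #|X|) (#|L| * m) (#|SL| * m) (#|SL| * d) #|X| => *; lia.
Qed.

Lemma v_notin_Y : v \notin Y.
Proof. by rewrite inE (negPf v_notin_c). Qed.

Lemma hop_Y_parts y : y \in Y -> pt y \in SL.
Proof. by move=> yY; apply: imset_f; rewrite in_setU1 yY orbT. Qed.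

Lemma card_Y_parts : #|Y| < #|SL| * m.
Proof.
have := v_notin_Y; rewrite -card_in_parts => vY.
suff : #|v |: Y| <= #|[set w | pt w \in SL]| by rewrite cardsU1 vY.
apply: subset_leq_card; apply/subsetP => y yY; rewrite inE; exact: imset_f.
Qed.

(** The neighbours of [w] avoid its own part, and they avoid [v |: Y] because the neighbours of that
    set lie in [X]. *)
Lemma card_free w : pt w \notin SL -> w \notin X -> d + m + #|Y| < #|T|.
Proof.
move=> wS wX; pose V := [set z | pt z == pt w].
have dVY : [disjoint V & v |: Y].
  rewrite disjoint_subset; apply/subsetP => z; rewrite !inE => /eqP zw.
  apply/negP => zY; case/negP: wS; rewrite -zw; apply: imset_f.
  by rewrite !inE.
have dN : [disjoint nbr e w & V :|: (v |: Y)].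
  rewrite disjoint_subset; apply/subsetP => z; rewrite in_nbr => wz.
  rewrite inE in_setU negb_or; apply/andP; split.
    by rewrite inE eq_sym ept.
  apply/negP => /nbr_hop/subsetP/(_ w); rewrite in_nbr eC wz (negPf wX).
  by move/(_ isT).
have U1 := cardsUI V (v |: Y); rewrite (disjoint_setI0 dVY) cards0 addn0 in U1.
have U2 := cardsUI (nbr e w) (V :|: (v |: Y)).
rewrite (disjoint_setI0 dN) cards0 addn0 U1 cardsU1 v_notin_Y /V card_part in U2.
have := max_card [in nbr e w :|: (V :|: (v |: Y))].
rewrite U2; have := degd w; clear; move: #|nbr e w| #|Y| #|T| => *; lia.
Qed.

Lemma card_succ_part w : w \in P -> pt v != pt w ->
  #|X| + 1 + m + #|nbr e w| <= #|T| + #|[set z in P | pt z == pt w]| /\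
  (#|T| + #|[set z in P | pt z == pt w]| <= #|X| + 1 + m + #|nbr e w| ->
   nbr e w = ~: ((v |: P) :|: [set z | pt z == pt w])).
Proof.
move=> wP vw; set V := [set z | pt z == pt w]; set I := v |: P.
have sub : nbr e w \subset ~: (I :|: V).
  apply/subsetP => z; rewrite in_nbr => wz; rewrite in_setC in_setU negb_or.
  apply/andP; split; last by rewrite inE eq_sym ept.
  apply/negP => zI; have := hop_successors_indep eC eI ec spc HX wP zI.
  by rewrite wz.
have vP : v \notin P.
  by rewrite in_succ; apply/negP => /(hop_sub HX); rewrite mem_prev (negPf v_notin_c).
have cI : #|I| = #|X| + 1 by rewrite cardsU1 vP card_succ addnC.
have U := cardsUI I V; rewrite cI /V card_part -/V in U.
have EIV : I :&: V = [set z in P | pt z == pt w].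
  apply/setP => z; rewrite in_setI in_setU1 !inE.
  by have [->|_] //= := eqVneq z v; rewrite (negPf vw) !andbF.
rewrite EIV in U; have UC := cardsC (I :|: V).
have le := subset_leq_card sub; split.
  by move: U UC le; clear; move: #|nbr e w| #|T| #|X| => *; lia.
move=> ge; apply/eqP; rewrite eqEcard sub.
by move: U UC ge; clear; move: #|nbr e w| #|T| #|X| => *; lia.
Qed.

End HopCounting.

(** * Exclusion of hopping sets *)

Section NoHopset.

Variables (T L : finType) (e : rel T) (pt : T -> L) (m d : nat).
Hypotheses (eC : symmetric e) (ept : forall x y, e x y -> pt x != pt y).
Hypothesis card_part : forall l, #|[set x | pt x == l]| = m.
Hypothesis degd : forall x, d <= #|nbr e x|.

Let eI := multipartite_irr ept.

(* For [k = 4] and [k = 6] the count based on [card_free] alone is not enough;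
   these bounds on [d] replace it. *)
Definition four_or_six :=
  (#|L| = 4 /\ 5 * m <= 3 * d + 1 /\ (5 * m = 3 * d + 1 -> 4 < m)) \/
  (#|L| = 6 /\ 8 * m < 3 * d + 2 /\ 35 * m < 13 * d + 5).

(** The degree of [w] forces many successors of [X] into its part. They lie in [W :\: X], which has
    at most [s (m - d) + (s - 1) #|X|] vertices for [s = k / 2]. *)
Lemma hop_succ_free_absurd c v X w : four_or_six ->
  cycle e c -> spans (v :: c) -> hopset e c v X ->
  2 * #|hop_parts pt c v X| = #|L| ->
  pt w \notin hop_parts pt c v X -> w \notin X -> w \in next c @: X -> False.
Proof.
move=> H46 ec spc HX sL wS wX wP.
set SL := hop_parts pt c v X in sL wS.
have outv u : pt u \notin SL -> pt v != pt u.
  by move=> uS; apply: contraNneq uS => <-; apply: imset_f; rewrite setU11.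
have YSL y : y \in sandwiched c X -> pt y \in SL by apply: hop_Y_parts.
set W := [set u | pt u \notin SL].
pose PV := [set z in next c @: X | pt z == pt w].
have PX z : z \in next c @: X -> z \notin X.
  by case/imsetP=> a aX ->; apply: (hop_next HX).
have PVW : PV \subset W :\: X.
  apply/subsetP => z; rewrite !inE => /andP[zP /eqP ->].
  by rewrite (PX z zP).
have le1 := subset_leq_card PVW.
have cW := card_W card_part c v X; have cWX := card_hop_W pt c v X.
have cS := card_hop_in_parts ept degd HX.
have cD := cardsID X W.
have cn := card_vertices card_part.
rewrite -/SL -/W in cW cWX cS.
have [p1 p2] := card_succ_part eC ept card_part ec spc HX wP (outv w wS).
have b1 := card_free eC ept card_part degd spc HX wS wX.
have b2 := card_sandwiched ec spc HX.
have dw := degd w; rewrite -/PV in p1 p2.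
case: H46 => -[k4 [h1 h2]]; rewrite k4 in sL cn cW; last first.
  have s3 : #|SL| = 3 by move: sL; clear; lia.
  rewrite s3 in cS cW; move: cS cW cWX cD cn le1 p1 b1 b2 dw h1 h2; clear.
  move: #|W| #|W :&: X| #|W :\: X| #|X| #|PV| #|nbr e w| #|T| #|sandwiched c X|.
  by move: #|[set _ in X | _]| => *; lia.
have s2 : #|SL| = 2 by move: sL; clear; lia.
have xd := degree_le_hop degd HX.
rewrite s2 in cS cW.
(* For four parts the count leaves only the case of equality throughout. *)
have [eqd eWX eN PV2] : [/\ 5 * m = 3 * d + 1, #|W :\: X| = #|PV|,
   #|T| + #|PV| <= #|X| + 1 + m + d & 3 * #|PV| >= m + 1].
  move: cS cW cWX cD cn le1 p1 b1 b2 dw h1 xd {p2 h2}; clear.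
  move: #|W| #|W :&: X| #|W :\: X| #|X| #|PV| #|nbr e w| #|T| #|sandwiched c X|.
  by move: #|[set _ in X | _]| => *; split; lia.
have m4 := h2 eqd.
have WXE : W :\: X = PV by apply/eqP; rewrite eq_sym eqEcard PVW eWX leqnn.
have wPV : w \in PV by rewrite inE wP eqxx.
(* Since [3 * #|PV| >= m + 1] and [m > 4], there is a second such successor; both have the same
   extremal neighbourhood. *)
have [w' w'PV ww] : exists2 w', w' \in PV & w != w'.
  have : 0 < #|PV :\ w| by have := cardsD1 w PV; rewrite wPV; move: PV2 m4; clear; lia.
  by case/card_gt0P => w'; rewrite !inE => /andP[n1 n2]; exists w'; rewrite ?inE // eq_sym.
have [w'P /eqP w'w] : w' \in next c @: X /\ pt w' == pt w.
  by move: w'PV; rewrite inE => /andP[].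
have w'S : pt w' \notin SL by rewrite w'w.
have [p1' p2'] := card_succ_part eC ept card_part ec spc HX w'P (outv w' w'S).
rewrite w'w -/PV in p1' p2'.
apply: (hop_same_nbrs_absurd eC ec spc HX wP w'P ww).
- by apply/negP => /YSL; rewrite (negPf wS).
- by apply/negP => /YSL; rewrite (negPf w'S).
- by apply: p2; move: eN dw; clear; lia.
- apply: p2'.
  by have := degd w'; move: eN; clear; lia.
move=> z zc zX zP; rewrite in_setC in_setU in_setU1 negb_or negb_or zP andbT inE.
apply/andP; split.
  by apply: contraTneq zc => ->; apply: v_notin_c spc.
apply: contra zP => zw; have : z \in W :\: X by rewrite !inE zX (eqP zw).
by rewrite WXE inE => /andP[].
Qed.

(** The first hypothesis refutes [card_hop_le] as soon as [v |: Y] meets more than half of the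
    parts. The second refutes the bounds obtained from a vertex outside [X] in one of the remaining
    parts. *)
Lemma no_hopset c v X :
  (forall x, d <= x -> 2 * x < #|T| -> x <= m + d /\
      #|T| + (#|L|./2).+1 * x < (#|L|./2).+1 * (m + d) + x) ->
  2 * #|T| <= 4 * d + m + 1 \/ four_or_six ->
  cycle e c -> spans (v :: c) -> ~ hopset e c v X.
Proof.
move=> hA hB ec spc HX; set SL := hop_parts pt c v X.
have uc := spans_cons_uniq spc.
have lt := card_hop_lt ec spc HX.
have xd := degree_le_hop degd HX.
have b2 := card_sandwiched ec spc HX.
have cn := card_vertices card_part.
have m0 : 0 < m.
  rewrite lt0n; apply: contraTneq lt => m0; rewrite cn m0 muln0; clear; lia.
have sk : #|SL| <= #|L|./2.
  rewrite leqNgt; apply/negP => sk.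
  have [xmd h2] := hA _ xd lt.
  have := card_hop_le ept card_part degd HX; rewrite -/SL.
  move: sk h2 xmd; clear; move: #|SL| #|L|./2.+1 #|T| #|X| (m + d) => s t n x md.
  nia.
set W := [set u | pt u \notin SL].
have cW := card_W card_part c v X; have cWX := card_hop_W pt c v X.
rewrite -/SL -/W in cW cWX.
have cY := card_Y_parts card_part X spc; rewrite -/SL in cY.
(* At least half of the vertices lie in [W], but fewer than half in [X]. *)
have [w wW wX] : exists2 w, w \in W & w \notin X.
  have : 0 < #|W :\: X|.
    have h1 : #|L| * m <= 2 * #|W|.
      have : #|L| <= 2 * (#|L| - #|SL|) by move: sk; clear; lia.
      have -> : #|W| = (#|L| - #|SL|) * m by rewrite mulnBl -cW addnK.
      by rewrite mulnA => h; rewrite leq_mul2r h orbT.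
    have := cardsID X W; have : #|W :&: X| <= #|X|.
      by apply: subset_leq_card; apply: subsetIr.
    by move: h1 lt; rewrite cn; clear; lia.
  by case/card_gt0P => w; rewrite !inE => /andP[n1 n2]; exists w; rewrite ?inE.
have wS : pt w \notin SL by move: wW; rewrite inE.
have b1 := card_free eC ept card_part degd spc HX wS wX.
(* From [d + m + #|Y| < n], [3 * #|X| < n + #|Y|] and [d <= #|X|] follows [4 d + m + 2 <= 2 n]. *)
case: hB => [hB|H46]; first by move: hB b1 b2 xd; clear; lia.
(* With fewer parts there would not be room for [Y]. *)
have sL : 2 * #|SL| = #|L|.
  move: H46 sk cY b2 xd; rewrite cn; clear.
  by case=> -[-> [h1 _]] /=; move: #|SL| #|X| #|sandwiched _ _| => s x y; nia.
(* If [W :\: X] contains no successor or predecessor of [X], there are too many vertices in total; a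
   predecessor becomes a successor on the reversed cycle. *)
have [Z0|] := boolP [disjoint W :\: X & (next c @: X) :|: (prev c @: X)].
  have vW : v \notin W :\: X.
    by rewrite !inE negb_and negbK; apply/orP; right; rewrite negbK; apply: imset_f; rewrite setU11.
  have dX : [disjoint W :\: X & X].
    by rewrite disjoint_subset; apply/subsetP => z; rewrite !inE => /andP[].
  have := card_outside spc HX vW Z0 dX; have := card_succ_pred ec spc HX.
  have := cardsID X W; have : #|W :&: X| <= #|X|.
    by apply: subset_leq_card; apply: subsetIr.
  move: H46 xd cW b1 sL; rewrite cn; clear.
  move: #|W| #|W :&: X| #|W :\: X| #|X| #|sandwiched _ _| #|_ :|: _| #|SL|.
  move=> w1 w2 w3 x y u s [] [E [h _]] xd cW b1 sL i1 i2 i3 i4; rewrite E in sL cW b1 i4.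
    have Es : s = 2 by lia.
    by rewrite Es in cW; lia.
  have Es : s = 3 by lia.
  by rewrite Es in cW; lia.
rewrite -setI_eq0 => /set0Pn[u] /setIP[/setDP[uW uX]].
have uS : pt u \notin SL by move: uW; rewrite inE.
case/setUP => uP.
  exact: (hop_succ_free_absurd H46 ec spc HX sL uS uX uP).
have HX' := hopset_rev spc HX.
have spc' : spans (v :: rev c) by apply: spans_perm spc; rewrite perm_cons perm_sym perm_rev.
have ec' : cycle e (rev c).
  by rewrite rev_cycle (eq_cycle (e' := e)) // => a b; rewrite eC.
have SLE : hop_parts pt (rev c) v X = SL.
  rewrite /SL /hop_parts; congr (_ @: (_ |: _)).
  apply/setP => y; rewrite !inE mem_rev prev_rev // next_rev //.
  by rewrite [X in _ && X]andbC.
apply: (hop_succ_free_absurd (w := u) H46 ec' spc' HX'); rewrite ?SLE //.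
by case/imsetP: uP => a aX ->; rewrite -next_rev //; apply: imset_f.
Qed.

End NoHopset.

(** * The degree bound *)

(** [h] is the ceiling of [n / 2] and [f] the quotient in the bound, described by inequalities fit
    for arithmetic; adding [m] removes the truncated subtraction. *)
Lemma bound_spec k m : 1 < k -> exists h f,
  [/\ degree_bound k (k * m) + m = h + f, k * m <= 2 * h <= k * m + 1,
      f * (k./2.+1).*2 <= k * m + 2 & k * m + 2 < f.+1 * (k./2.+1).*2].
Proof.
move=> k2; have k0 : 0 < k by apply: ltnW.
have tE : 2 * uphalf (k + 1) = (k./2.+1).*2 by clear -k0; lia.
exists (uphalf (k * m)), ((k * m + 2) %/ (k./2.+1).*2); split.
- rewrite /degree_bound mulKn // tE subnK //.
  have : 2 * m <= k * m by rewrite leq_mul2r k2 orbT.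
  by set f := (_ %/ _); move: f (k * m) => f n; clear; lia.
- by move: (k * m) => n; clear; lia.
- exact: leq_divM.
- by apply: ltn_ceil.
Qed.

(* With [n = k * m], the exception [k = n / 2] reads [m = 2]. *)
Definition admissible k m :=
  ~~ ((k == 2) && (4 %| k * m)) && ~~ ((m == 2) && (4 %| k * m)).

(** [t] is the least number of parts exceeding half. Writing [h = x + z + 1], one has
    [t (m + d - x) = t (f + 1) + t z]; here [2 t (f + 1) > n + 2], which is what the quotient in the
    bound provides, while [n - x <= n / 2 + z + 1]. *)
Lemma bound_met k m x : 2 < k -> let t := k./2.+1 in let d := degree_bound k (k * m) in
  d <= x -> 2 * x < k * m -> x <= m + d /\ k * m + t * x < t * (m + d) + x.
Proof.
move=> k3 t d dx xn; have [h [f [hd hn f1 f2]]] := bound_spec m (ltnW k3).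
rewrite -/d -/t in hd f1 f2; rewrite [m + d]addnC hd.
have t1 : 1 < t by move: k3; rewrite /t; clear; lia.
have [z hE] : exists z, h = x + z.+1 by exists (h - x).-1; move: hn xn; clear; lia.
split; first by rewrite hE; clear; lia.
have tz : z.*2 <= t * z by rewrite -mul2n leq_mul2r t1 orbT.
rewrite hE !mulnDr mulnS; rewrite hE in hn; move: f2 hn xn tz; rewrite -doubleMr mulSn.
rewrite [f * t]mulnC; move: (k * m) (t * x) (t * f) (t * z) (t.*2) => n a b c t2; clear; lia.
Qed.

Lemma bound_m1 k : 1 < k -> uphalf k = degree_bound k (k * 1).
Proof.
move=> k2; have [h [f [hd hn f1 f2]]] := bound_spec 1 k2.
move: hd hn f1 f2; rewrite muln1 => hd hn f1 f2.
have : f = 1.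
  by case: f hd f1 f2 => [|[|f]] hd f1 f2 //; move: f1 f2 k2; clear; [lia | nia].
by move: hd hn; clear; lia.
Qed.

(** As [2 h >= n], it suffices that [m < 2 f]. For even [k] this fails at [m = 2], a case that
    [admissible] rules out. *)
Lemma bound_connected k m : 2 < k -> 0 < m -> admissible k m ->
  k * m < 2 * degree_bound k (k * m) + m.
Proof.
move=> k3 m0 adm.
have [m1|m1] := eqVneq m 1.
  by rewrite m1 -(bound_m1 (ltnW k3)) muln1; clear; lia.
have [h [f [hd hn f1 f2]]] := bound_spec m (ltnW k3).
set d := degree_bound k _ in hd *; clearbody d.
suff : m < 2 * f by move: hd hn; move: (k * m) => n; clear; lia.
rewrite ltnNge; apply/negP => fm.
have [ok|ek] := boolP (odd k).
  have kE : k = (k./2).*2.+1 by clear -ok; lia.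
  move: f2 fm m1 m0 k3; rewrite kE; move: k./2 => j; clear; nia.
have kE : k = (k./2).*2 by clear -ek; lia.
have m2 : m != 2.
  apply: contraTneq adm => m2; rewrite /admissible m2 eqxx negb_and !negbK /=.
  by apply/orP; right; clear -ek; lia.
have [k4|k4] := eqVneq k 4.
  move: f2 fm m1 m0 m2; rewrite k4 /=; clear; lia.
move: f2 fm m1 m0 k3 m2 k4; rewrite kE; move: k./2 => j; clear; nia.
Qed.

(** Here [f] is the floor of [(2 m + 1) / 3], so [3 f + 1 >= 2 m], with equality only if [m] is 2
    modulo 3; as [m = 2] is inadmissible, equality needs [m >= 5]. *)
Lemma bound_four m : 0 < m -> admissible 4 m ->
  let d := degree_bound 4 (4 * m) in 5 * m <= 3 * d + 1 /\ (5 * m = 3 * d + 1 -> 4 < m).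
Proof.
move=> m0 adm d; have [h [f [hd hn f1 f2]]] := bound_spec m (isT : 1 < 4).
rewrite -/d /= in hd f1 f2.
have m2 : m != 2 by apply: contraTneq adm => ->.
by move: hd hn f1 f2 m0 m2; clear; lia.
Qed.

Lemma bound_six m : 0 < m -> admissible 6 m ->
  let d := degree_bound 6 (6 * m) in 8 * m < 3 * d + 2 /\ 35 * m < 13 * d + 5.
Proof.
move=> m0 adm d; have [h [f [hd hn f1 f2]]] := bound_spec m (isT : 1 < 6).
rewrite -/d /= in hd f1 f2.
have m2 : m != 2 by apply: contraTneq adm => ->.
by move: hd hn f1 f2 m0 m2; clear; lia.
Qed.

Lemma bound_ratio k m : 2 < k -> 0 < m -> admissible k m ->
  2 * (k * m) <= 5 * degree_bound k (k * m).
Proof.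
move=> k3 m0 adm.
have [m1|m1] := eqVneq m 1.
  by rewrite m1 -(bound_m1 (ltnW k3)) muln1; clear -k3; lia.
have [k4|k4] := eqVneq k 4.
  rewrite k4 in adm *; have [h1 h2] := bound_four m0 adm.
  by have m2 : m != 2 by [apply: contraTneq adm => ->]; move: h1 h2 m1 m0 m2; clear; lia.
have [h [f [hd hn f1 f2]]] := bound_spec m (ltnW k3).
set d := degree_bound k _ in hd *; clearbody d.
have [k3'|k3'] := eqVneq k 3.
  by move: hd hn f1 f2 m1 m0; rewrite k3' /=; clear; lia.
suff : 10 * m <= 10 * f + k * m by move: hd hn; move: (k * m) => n; clear; lia.
rewrite leqNgt; apply/negP => fm.
have m2 : 2 <= m by clear -m1 m0; lia.
have [ok|ek] := boolP (odd k).
  have kE : k = (k./2).*2.+1 by clear -ok; lia.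
  move: f2 fm m2 k3 k3'; rewrite kE; move: k./2 => j; clear; nia.
have kE : k = (k./2).*2 by clear -ek; lia.
move: f2 fm m2 k3 k4; rewrite kE; move: k./2 => j; clear; nia.
Qed.

(** The claim comes down to [3 m <= 4 f + 1], which fails for instance for [k = 4], [m = 5] and for
    [k = 6], [m = 6]. *)
Lemma bound_free k m : 2 < k -> 0 < m -> admissible k m -> k != 4 -> k != 6 ->
  2 * (k * m) <= 4 * degree_bound k (k * m) + m + 1.
Proof.
move=> k3 m0 adm k4 k6.
have [m1|m1] := eqVneq m 1.
  by rewrite m1 -(bound_m1 (ltnW k3)) muln1; clear -k3; lia.
have [h [f [hd hn f1 f2]]] := bound_spec m (ltnW k3).
set d := degree_bound k _ in hd *; clearbody d.
suff : 3 * m <= 4 * f + 1 by move: hd hn; move: (k * m) => n; clear; lia.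
rewrite leqNgt; apply/negP => fm.
have [ok|ek] := boolP (odd k).
  have kE : k = (k./2).*2.+1 by clear -ok; lia.
  move: f2 fm m1 m0 k3; rewrite kE; move: k./2 => j; clear; nia.
have kE : k = (k./2).*2 by clear -ek; lia.
have m2 : m != 2.
  apply: contraTneq adm => m2; rewrite /admissible m2 eqxx negb_and !negbK /=.
  by apply/orP; right; clear -ek; lia.
have [k8|k8] := eqVneq k 8.
  by move: f2 fm m1 m0 m2; rewrite k8 /=; clear; lia.
have [k10|k10] := eqVneq k 10.
  by move: f2 fm m1 m0 m2; rewrite k10 /=; clear; lia.
move: f2 fm m1 m0 k3 m2 k4 k6 k8 k10; rewrite kE; move: k./2 => j; clear; nia.
Qed.

(** * Hamiltonicity *)

Section MultipartiteHamiltonian.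

Variables (T L : finType) (e : rel T) (pt : T -> L) (m d : nat).
Hypotheses (eC : symmetric e) (ept : forall x y, e x y -> pt x != pt y).
Hypothesis card_part : forall l, #|[set x | pt x == l]| = m.
Hypothesis degd : forall x, d <= #|nbr e x|.
Hypothesis nh : ~~ hamb e.

Let eI := multipartite_irr ept.

(** Take for [Q] the other vertices in the part of the tail: they are not adjacent to the tail, and
    their path successors lie in the part of the head. Ore's count becomes [2 d + (m - 1) < 2 m]. *)
Lemma bipartite_path_bound x0 s : #|L| = 2 -> spans s -> sorted e s ->
  pt (head x0 s) != pt (last x0 s) -> 2 * d <= m.
Proof.
move=> L2 sp ps hl; set h := head x0 s in hl; set l := last x0 s in hl.
have two a b a' : a != b -> a' != b -> a = a' :> L.
  move=> ab a'b; apply/eqP; apply: contraT => aa.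
  have : uniq [:: a; b; a'] by rewrite /= !inE negb_or ab aa eq_sym a'b.
  by move/card_uniqP => u3; have := max_card [in [:: a; b; a']]; rewrite u3 L2.
pose Q := [set y | pt y == pt l] :\ l.
have cQ : #|Q|.+1 = m.
  by rewrite -(card_part (pt l)) (cardsD1 l [set y | pt y == pt l]) inE eqxx.
have us : uniq s by case/andP: sp.
have := ore_gap (x0 := x0) (Q := Q) eC eI nh sp ps.
rewrite setD11 => /(_ isT) G.
have {G} : #|nbr e h| + #|nbr e l| + #|Q| < #|T|.
  apply: G => y; rewrite -/h -/l in_setD1 inE => /andP[yl /eqP yp].
  apply/andP; split; first by apply/negP => /ept; rewrite yp eqxx.
  have [s1 [b [s2 Es]]] := split_after (spans_mem y sp) yl.
  have nE : next s y = b by rewrite Es next_adjacent // -Es.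
  have yb : e y b.
    move: ps; rewrite Es -[y :: b :: s2]/([:: y] ++ b :: s2) catA (sorted_cat_ne x0) //.
      by rewrite last_cat => /and3P[].
    by case: (s1).
  rewrite nE; apply/negP => /ept/negP; apply; apply/eqP.
  by apply: (two _ (pt l)); rewrite // eq_sym -yp ept.
have := degd h; have := degd l; rewrite (card_vertices card_part) L2.
by move: cQ; clear; lia.
Qed.

(** Induction on the gap [q]. A neighbour of either end inside [q] would give a closer crossing; if
    there is none, Ore's count makes [q] short enough for [absorb_path], and hopping applies to the
    resulting cycle. *)
Lemma no_crossing_of_no_hopset : 2 < #|L| -> 0 < m -> 0 < d ->
  2 * #|T| <= 5 * d ->
  (forall c v X, cycle e c -> spans (v :: c) -> ~ hopset e c v X) ->
  forall x0 s1 q s2, ~ crossing e x0 s1 q s2.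
Proof.
move=> k3 m0 d0 bd noX x0 s1 q s2.
have [N] := ubnP (size q); elim: N s1 q s2 => // N IH s1 q s2 le_N.
case=> s1n s2n sp ps /andP[hh ll].
have pq : spans ((s1 ++ rev s2) ++ q).
  apply: spans_perm sp; apply/permP => a; rewrite !count_cat count_rev.
  by rewrite -!addnA [count a q + _]addnC.
have [p1 [p2 pq']] : sorted e s1 /\ sorted e s2 /\ sorted e q.
  have [q0|qn] := eqVneq q [::].
    by move: ps; rewrite q0 /= (sorted_cat_ne x0) // => /and3P[].
  move: ps; rewrite (sorted_cat_ne x0) ?cat_nil_eq ?(negPf qn) //.
  by rewrite (sorted_cat_ne x0) // => /and3P[-> /and3P[-> -> _] _].
have cc : cycle e (s1 ++ rev s2).
  by apply: (crossing_cycle (x0 := x0)) => //; rewrite eC.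
have hd : head x0 (s1 ++ q ++ s2) = head x0 s1 by rewrite head_cat_ne.
have la : last x0 (s1 ++ q ++ s2) = last x0 s2.
  by rewrite !last_cat_ne // cat_nil_eq negb_and s2n orbT.
have qn : q != [::].
  apply/negP => /eqP q0; case/negP: nh; apply/hambP.
  by exists (s1 ++ rev s2) => //; rewrite q0 cats0 in pq.
have nl : {in q, forall y, ~~ e (last x0 s2) y}.
  move=> y yq; apply/negP => ly.
  move: sp ps le_N {pq pq' qn hd la}; case/splitPr: yq => q1 q2 sp ps le_N.
  have E : s1 ++ (q1 ++ y :: q2) ++ s2 = (s1 ++ rcons q1 y) ++ q2 ++ s2.
    by rewrite -cats1 -!catA.
  apply: (IH (s1 ++ rcons q1 y) q2 s2).
    by move: le_N; rewrite size_cat /=; clear; lia.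
  split; rewrite -?E //; first by rewrite cat_nil_eq (negPf s1n).
  by rewrite head_cat_ne // hh last_cat last_rcons ly.
have nhd : {in q, forall y, ~~ e (head x0 s1) y}.
  move=> y yq; apply/negP => ly.
  move: sp ps le_N {pq pq' qn hd la nl}; case/splitPr: yq => q1 q2 sp ps le_N.
  have E : s1 ++ (q1 ++ y :: q2) ++ s2 = s1 ++ q1 ++ (y :: q2) ++ s2.
    by rewrite -!catA.
  apply: (IH s1 q1 ((y :: q2) ++ s2)).
    by move: le_N; rewrite size_cat /=; clear; lia.
  by split; rewrite -?E // last_cat_ne //= ly ll.
have gap : size q + 2 * d <= #|T|.
  have [q0 [z Eq]] : exists q0 z, q = rcons q0 z.
    by case/lastP: (q) qn => // q0 z _; exists q0, z.
  have us : uniq (s1 ++ q ++ s2) by case/andP: sp.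
  (* The last vertex of [q] is left out of [Q] because its successor, the head of [s2], is adjacent
     to the head of the path. *)
  have := ore_gap (x0 := x0) (Q := [set y in q0]) eC eI nh sp ps.
  rewrite hd la => G.
  have {G} : #|nbr e (head x0 s1)| + #|nbr e (last x0 s2)| + #|[set y in q0]| < #|T|.
    apply: G.
      rewrite inE; move: us; rewrite !cat_uniq => /and3P[_ _ /and3P[_ /hasPn H _]].
      have := H _ (last_in x0 s2n); apply: contraNN => /= lq.
      by rewrite Eq mem_rcons inE lq orbT.
    move=> y; rewrite inE => yq.
    rewrite nl /=; last by rewrite Eq mem_rcons inE yq orbT.
    move: Eq; case/splitPr: yq => a1 a2; rewrite -cats1 -catA cat_cons => Eq.
    have [b [a3 Eb]] : exists b a3, a2 ++ [:: z] = b :: a3.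
      by case: (a2) => [|b a3]; [exists z, [::] | exists b, (a3 ++ [:: z])].
    have Es : s1 ++ q ++ s2 = (s1 ++ a1) ++ y :: b :: (a3 ++ s2).
      by rewrite Eq Eb -!catA.
    rewrite Es next_adjacent -?Es //; apply: nhd.
    by rewrite Eq Eb mem_cat !inE eqxx !orbT.
  have uq : uniq q0.
    by move: us; rewrite Eq !cat_uniq rcons_uniq => /and3P[_ _ /and3P[/andP[]]].
  have -> : #|[set y in q0]| = size q0 by rewrite cardsE; apply/card_uniqP.
  rewrite Eq size_rcons.
  by have := degd (head x0 s1); have := degd (last x0 s2); clear; lia.
have cn : s1 ++ rev s2 != [::] by rewrite cat_nil_eq (negPf s1n).
have [c [v [ec spc]]] := absorb_path x0 eC eI nh degd bd cn qn cc pq' pq gap.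
have cn' : c != [::].
  apply/negP => /eqP c0; move: (spc); rewrite c0 => /andP[_ /eqP] /=.
  rewrite (card_vertices card_part) => E; move: k3 m0; clear -E; nia.
have [X HX] := hopping eC eI nh ec spc cn'.
exact: noX ec spc HX.
Qed.

End MultipartiteHamiltonian.

Lemma multipartite_ham (T L : finType) (e : rel T) (pt : T -> L) (m : nat) :
  symmetric e -> (forall x y, e x y -> pt x != pt y) ->
  (forall l, #|[set x | pt x == l]| = m) ->
  1 < #|L| -> 2 < #|T| -> admissible #|L| m ->
  (forall x, degree_bound #|L| #|T| <= #|nbr e x|) -> hamb e.
Proof.
move=> eC ept cp k2 n3 adm degd; apply: contraT => nh.
have cn := card_vertices cp; set d := degree_bound _ _ in degd.
have m0 : 0 < m by rewrite lt0n; apply: contraTneq n3 => m0; rewrite cn m0 muln0.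
pose r1 : rel T := fun x y => pt x != pt y.
have r1C : symmetric r1 by move=> x y; rewrite /r1 eq_sym.
have [r2 [r2C s12 s21 nh2 sat]] := saturation n3 eC r1C ept nh.
have deg2 x : d <= #|nbr r2 x|.
  apply: leq_trans (degd x) _; apply: subset_leq_card; apply/subsetP => y.
  by rewrite !in_nbr; apply: s12.
(* The complete multipartite graph is Hamiltonian and [r2] is not, so some pair across two parts is
   missing. *)
have [x [y [xy nxy]]] : exists x y, r1 x y /\ ~~ r2 x y.
  have [|H] := boolP [exists p : T * T, r1 p.1 p.2 && ~~ r2 p.1 p.2].
    by case/existsP => -[x y] /andP[]; exists x, y.
  case/negP: nh2; have /hambP[c cc sc] := complete_multipartite_ham cp k2 n3.
  apply/hambP; exists c => //; apply: sub_cycle cc => x y xy.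
  by apply: contraT => nxy; case/existsP: H; exists (x, y); rewrite /= /r1 xy.
have [s [sp ps hs ls]] := sat x y xy nxy.
have [k2'|kn2] := eqVneq #|L| 2.
  have := @bipartite_path_bound _ _ _ _ _ _ r2C s21 cp deg2 nh2 x s k2' sp ps.
  have ls' : last x s = y by case: (s) sp ls => //= /andP[_ /eqP /=]; move: n3; lia.
  rewrite hs ls' => /(_ xy); rewrite /d cn k2'.
  have [h [f [hd hn f1 f2]]] := bound_spec m (isT : 1 < 2).
  move: adm; rewrite k2' /admissible /= => /andP[adm _].
  by move: hd hn f1 f2 adm => /=; clear; lia.
have k3 : 2 < #|L| by clear -k2 kn2; lia.
have dE : d = degree_bound #|L| (#|L| * m) by rewrite /d cn.
have b1 := bound_connected k3 m0 adm; have b2 := bound_ratio k3 m0 adm.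
rewrite -dE -cn in b1 b2.
have d0 : 0 < d by move: n3 b2; clear; lia.
have noX c v X : cycle r2 c -> spans (v :: c) -> ~ hopset r2 c v X.
  apply: (no_hopset (d := d) r2C s21 cp deg2).
    move=> u du un; rewrite dE in du *; rewrite cn in un *.
    exact: bound_met k3 du un.
  have [k4|k4] := eqVneq #|L| 4.
    right; left; split=> //.
    by have := bound_four m0; rewrite -k4 -dE; apply.
  have [k6|k6] := eqVneq #|L| 6.
    right; right; split=> //.
    by have := bound_six m0; rewrite -k6 -dE; apply.
  by left; rewrite dE cn; apply: bound_free.
have nocr := no_crossing_of_no_hopset r2C s21 cp deg2 nh2 k3 m0 d0 b2 noX.
(* Any neighbour of the head cuts the path into a block with adjacent ends and a remainder, the
   starting point of the extremal argument. *)
have [z xz] : exists z, r2 x z.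
  have : 0 < #|nbr r2 x| by apply: leq_trans d0 (deg2 x).
  by case/card_gt0P => z; rewrite in_nbr; exists z.
have zs := spans_mem z sp.
move: sp ps hs ls; case/splitPr: zs => t1 t2; rewrite -cat_rcons => sp ps hs ls.
have rn : rcons t1 z != [::] by case: (t1).
exfalso; apply: (no_crossing_absurd r2C s21 cp deg2 b1 (nocr x) sp ps rn).
by rewrite last_rcons -(head_cat_ne x t2 rn) hs.
Qed.

(** * Transfer to balanced multipartite graphs *)

Lemma min_degree_le (G : sgraph) (x : G) : min_degree G <= degree x.
Proof.
rewrite /min_degree; have : x \in index_enum G by rewrite mem_index_enum.
elim: (index_enum G) => // y s IH; rewrite inE big_cons geq_min => /orP[/eqP->|/IH->].
  by rewrite leqnn.
by rewrite orbT.
Qed.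

Lemma degree_boundE k n : 2 <= k -> k %| n ->
  degree_bound k n =
    (if odd k then uphalf n + (n + 2) %/ (k + 1) - n %/ k
     else n %/ 2 + (n + 2) %/ (k + 2) - n %/ k).
Proof.
move=> k2 kn; rewrite /degree_bound; have [ok|ek] := boolP (odd k).
  by have -> : 2 * uphalf (k + 1) = k + 1 by clear -ok; lia.
have -> : 2 * uphalf (k + 1) = k + 2 by clear -ek; lia.
suff -> : uphalf n = n %/ 2 by [].
have : 2 %| n by apply: dvdn_trans kn; rewrite dvdn2.
by clear; lia.
Qed.

Theorem theorem1p1 (k n : nat) (hk : 2 <= k) (hn : 3 <= n) (hkn : k %| n) :
  degree_bound k n =
    (if odd k then uphalf n + (n + 2) %/ (k + 1) - n %/ k
     else n %/ 2 + (n + 2) %/ (k + 2) - n %/ k)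
  /\
  (forall G : sgraph,
     balanced_kpartite k n G ->
     degree_bound k n <= min_degree G ->
     ~ (k = 2 /\ 4 %| n \/ k = n %/ 2 /\ 4 %| n) ->
     hamiltonian G).
Proof.
split; first exact: degree_boundE.
move=> G [Gn _ [P [Ppart Pk Pind]]] deg exc.
have /and3P[/eqP covP tiP _] := Ppart.
(* The parts themselves serve as labels, and [pblock] sends a vertex to its part. *)
pose L : finType := {A : {set G} | A \in P}.
have ptP (x : G) : pblock P x \in P by rewrite pblock_mem // covP inE.
pose pt (x : G) : L := exist _ (pblock P x) (ptP x).
have k0 : 0 < k by apply: ltnW.
have cL : #|L| = k by rewrite card_sig -Pk; apply: eq_card.
have nE : n = k * (n %/ k) by rewrite mulnC divnK.
have ptE (x : G) (l : L) : (pt x == l) = (x \in val l).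
  rewrite -val_eqE /=; apply/eqP/idP => [<-|xl].
    by rewrite mem_pblock covP inE.
  by apply: def_pblock => //; apply: valP l.
have /hambP[c cc /andP[uc /eqP sc]] : hamb (@adj G).
  apply: (multipartite_ham (pt := pt) (m := n %/ k)).
  - exact: adj_sym.
  - move=> x y xy; apply/eqP => /eqP; rewrite ptE /= => xB.
    have [ind _] := Pind _ (ptP y).
    have := ind x y xB; rewrite xy mem_pblock covP inE; exact: (fun h => elimN idP (h isT) isT).
  - move=> l; rewrite -Gn; have [_ <-] := Pind _ (valP l).
    by apply: eq_card => x; rewrite inE ptE.
  - by rewrite cL.
  - by rewrite Gn.
  - rewrite cL /admissible -nE; apply/andP; split; apply/negP => /andP[/eqP E n4].
      by apply: exc; left.
    by apply: exc; right; split=> //; rewrite nE E mulnK.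
  by move=> x; rewrite cL Gn; apply: leq_trans deg (min_degree_le x).
exists c; split=> //; first by rewrite sc Gn.
by move=> x; apply: spans_mem; rewrite /spans uc sc eqxx.
Qed.
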